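(* Let $\mathcal{G}=(V,\sigma,E_2\cup\dots\cup E_{n-1})$ be a signed colored graph of type $(n,n)$ such that: (1) $\mathcal G$ obeys Axiom 1; (2) $V\subseteq S_n$; (3) $\sigma(v)$ is the signature (given by inverse descents) of the permutation $v$; (4) for all $1<i<n$ and all $v\in V$ admitting an $i$-edge, $E_i(v)$ is Knuth equivalent to $d_i(v)$. Then $P\colon V\to\mathrm{SYT}(n)$ induces a morphism $\phi\colon\mathcal{G}\to\bigcup_{\lambda\vdash n}\mathcal{G}_\lambda$. Furthermore, \[\sum_{v\in V}F_{\sigma(v)}(X)=\sum_{\lambda\vdash n}\bigl|V\cap\mathrm{SYam}(\lambda)\bigr|\, s_\lambda .\]
   Context: Tableaux are in French notation (rows numbered bottom to top). $P(w)$ is the Robinson–Schensted insertion tableau of $w\in S_n$; two permutations are Knuth equivalent if they have the same insertion tableau. $U_\lambda$ is the standard Young tableau of shape $\lambda$ filled with $1,\dots,n$ row by row from bottom to top, each row left to right, and $\mathrm{SYam}(\lambda)=\{w\in S_n: P(w)=U_\lambda\}$. For $w\in S_n$, $\sigma(w)\in\{\pm1\}^{n-1}$ with $\sigma(w)_i=+1$ if $i$ appears before $i+1$ in $w$, $-1$ otherwise; a tableau's signature is that of its row reading word (rows read left to right, from the top row down). For $1<i<n$, $d_i$ fixes $w$ if the value $i$ lies positionally between $i-1$ and $i+1$; otherwise it interchanges $i$ with whichever of $i-1,i+1$ is not in the middle of the three positions; $d_i$ acts on tableaux via row reading words. For $\lambda\vdash n$, $\mathcal{G}_\lambda$ has vertex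 set $\mathrm{SYT}(\lambda)$, tableau signatures, and $i$-edges $\{T,d_i(T)\}$ with $d_i(T)\ne T$, $1<i<n$. A signed colored graph of type $(n,n)$ consists of a finite vertex set $V$, sets $E_i$ ($1<i<n$) of unordered pairs of distinct vertices, and $\sigma\colon V\to\{\pm1\}^{n-1}$; a morphism sends $i$-edges to $i$-edges and preserves signatures. A vertex $v$ admits an $i$-neighbor (equivalently, under Axiom 1, an $i$-edge) if $\sigma(v)_{i-1}=-\sigma(v)_i$. Axiom 1: each $E_i$ is a complete matching on the set of vertices admitting an $i$-neighbor; then $E_i(v)$ denotes the vertex matched with $v$. For $\sigma\in\{\pm1\}^{n-1}$, the fundamental quasisymmetric function is $F_\sigma(X)=\sum x_{i_1}\cdots x_{i_n}$, summed over $i_1\le\dots\le i_n$ (positive integers) such that $i_j=i_{j+1}$ implies $\sigma_j=+1$. $s_\lambda$ is the Schur function. *)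

(* Defs.v *)
From HB Require Import structures.
From mathcomp Require Export all_boot all_algebra perm finmap monalg.

Set Implicit Arguments.
Unset Strict Implicit.
Unset Printing Implicit Defensive.

Import GRing.Theory.
Local Open Scope fset_scope.
Local Open Scope nat_scope.

(* One-line notation with letters 1, ..., n ('S_n itself acts on 0, ..., n-1). *)
Definition word (n : nat) (w : 'S_n) : seq nat := [seq (w j).+1 | j : 'I_n].

(* Signatures: [true] is +1 and [false] is -1.  The entries are numbered from
   1 to n-1, hence the shift in [sgn]. *)
Definition signs (n : nat) := n.-1.-tuple bool.

Definition sgn (n : nat) (s : signs n) (i : nat) : bool := nth false s i.-1.

(* The entry numbered i = j+1 is +1 when i appears before i+1. *)
Definition signature (n : nat) (w : seq nat) : signs n :=
  [tuple index j.+1 w < index j.+2 w | j < n.-1].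

Definition between (p q r : nat) : bool := (p < q < r) || (r < q < p).

Definition exchange (a b : nat) (w : seq nat) : seq nat :=
  [seq if x == a then b else if x == b then a else x | x <- w].

Definition dword (i : nat) (w : seq nat) : seq nat :=
  let p := index i.-1 w in let q := index i w in let r := index i.+1 w in
  if between p q r then w
  else if between q p r then exchange i i.+1 w
  else exchange i.-1 i w.

Definition is_intpart (n : nat) (la : seq nat) : bool :=
  [&& sorted geq la, 0 \notin la & sumn la == n].

Record intpart (n : nat) := Intpart {
  intpart_val :> seq nat;
  intpartP : is_intpart n intpart_val
}.

HB.instance Definition _ n := [isSub for @intpart_val n].
HB.instance Definition _ n := [Countable of intpart n by <:].

Section IntpartFinite.
Variable n : nat.

Lemma intpart_bounded (la : intpart n) :
  (size la <= n) && all (fun k => k < n.+1) la.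
Proof.
case: la => la /= /and3P[_ la0 /eqP <-]; apply/andP; split.
  elim: la la0 => //= k la IH; rewrite inE negb_or eq_sym -lt0n.
  by case/andP=> k0 /IH; rewrite -add1n; apply: leq_add.
elim: la {la0} => //= k la IH; rewrite ltnS leq_addr /=.
by apply: sub_all IH => j; rewrite !ltnS => /leq_trans; apply; apply: leq_addl.
Qed.

Definition intpart_code (la : intpart n) : {bseq n of 'I_n.+1} :=
  insub_bseq n [seq inord k | k <- la].

Definition intpart_decode (s : {bseq n of 'I_n.+1}) : option (intpart n) :=
  insub [seq val k | k <- s].

Lemma intpart_codeK : pcancel intpart_code intpart_decode.
Proof.
move=> la; rewrite /intpart_decode /intpart_code; have /andP[sz bd] := intpart_bounded la.
rewrite /insub_bseq insubdK; last by rewrite -topredE /= size_map.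
suff -> : [seq val k | k <- [seq inord k | k <- la] : seq 'I_n.+1] = la.
  by rewrite valK.
rewrite -map_comp -[RHS]map_id; apply/eq_in_map => k kla.
by rewrite /= inordK //; move/allP: bd; apply.
Qed.

HB.instance Definition _ := isFinite.Build (intpart n) (pcan_enumP intpart_codeK).

End IntpartFinite.

(* A filling is the list of its rows, from bottom to top (French notation). *)
Definition tableau := seq (seq nat).

Definition rword (T : tableau) : seq nat := flatten (rev T).

Definition col_strict (lower upper : seq nat) : bool :=
  (size upper <= size lower) &&
  [forall c : 'I_(size upper), nth 0 lower c < nth 0 upper c].

Definition is_ssyt (T : tableau) : bool :=
  all (sorted leq) T && sorted col_strict T.

Definition is_syt (n : nat) (la : seq nat) (T : tableau) : bool :=
  [&& shape T == la, perm_eq (flatten T) (iota 1 n),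
      all (sorted ltn) T & sorted col_strict T].

(* The finite set of all T satisfying [is_syt n la], see [in_SYT]. *)
Definition SYT (n : nat) (la : intpart n) : {fset tableau} :=
  [fset T in [seq reshape la w | w <- permutations (iota 1 n)] | is_syt n la T].

Lemma in_SYT (n : nat) (la : intpart n) (T : tableau) :
  (T \in SYT la) = is_syt n la T.
Proof.
rewrite !inE /=; apply/andb_idl => /and4P[/eqP shT pT _ _].
apply/mapP; exists (flatten T); first by rewrite mem_permutations.
by rewrite -shT flattenK.
Qed.

(* d_i(T) is the filling of the shape of T whose row reading word is
   d_i of the row reading word of T. *)
Definition dtab (i : nat) (T : tableau) : tableau :=
  rev (reshape (rev (shape T)) (dword i (rword T))).

Fixpoint insert (T : tableau) (x : nat) : tableau :=
  if T is r :: T' then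
    let k := find (fun y => x < y) r in
    if k < size r then set_nth 0 r k x :: insert T' (nth 0 r k)
    else rcons r x :: T'
  else [:: [:: x]].

Definition Ptab (w : seq nat) : tableau := foldl insert [::] w.

Definition knuth_equiv (u v : seq nat) : Prop := Ptab u = Ptab v.

Definition Utab (n : nat) (la : intpart n) : tableau := reshape la (iota 1 n).

Definition SYam (n : nat) (la : intpart n) : {fset 'S_n} :=
  [fset w : 'S_n | Ptab (word w) == Utab la].

(* Only the edge sets of index 1 < i < n and the values of [sig] on [vert]
   are meaningful. *)
Record scgraph (n : nat) (K : choiceType) := SCGraph {
  vert : {fset K};
  edges : nat -> {fset {fset K}};
  sig : K -> signs n;
  edges_pair : forall i e, e \in edges i -> (e `<=` vert) && (#|` e| == 2)
}.

Definition scg_morphism (n : nat) (K L : choiceType)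
    (G : scgraph n K) (H : scgraph n L) (f : K -> L) : Prop :=
  [/\ forall v, v \in vert G -> f v \in vert H,
      forall v, v \in vert G -> sig H (f v) = sig G v
    & forall i u v, 1 < i < n ->
        [fset u; v] \in edges G i -> [fset f u; f v] \in edges H i].

Definition admits (n : nat) (s : signs n) (i : nat) : bool :=
  sgn s i.-1 != sgn s i.

Definition complete_matching (K : choiceType)
    (W : {fset K}) (M : {fset {fset K}}) : Prop :=
  (forall e, e \in M -> (e `<=` W) && (#|` e| == 2)) /\
  (forall v, v \in W -> exists! e, (e \in M) && (v \in e)).

Definition axiom1 (n : nat) (K : choiceType) (G : scgraph n K) : Prop :=
  forall i, 1 < i < n ->
    complete_matching [fset v in vert G | admits (sig G v) i] (edges G i).

(* E_i(v); the default value v is irrelevant when v is matched. *)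
Definition nbr (n : nat) (K : choiceType) (G : scgraph n K) (i : nat) (v : K) : K :=
  if [pick u : vert G | [fset v; val u] \in edges G i] is Some u then val u else v.

(* The pairs {T, d_i(T)} with d_i(T) <> T.  Requiring U to be in SYT(la) is
   harmless as d_i preserves SYT(la). *)
Definition tab_edges (n : nat) (la : intpart n) (i : nat) : {fset {fset tableau}} :=
  [fset [fset T; U] | T in SYT la, U in SYT la & (U == dtab i T) && (U != T)].

Lemma tab_edges_pair (n : nat) (la : intpart n) (i : nat) e :
  e \in tab_edges la i -> (e `<=` SYT la) && (#|` e| == 2).
Proof.
case/imfset2P => /= T TS [U]; rewrite inE => /and3P[US _ UT] ->.
rewrite cardfs2 (eq_sym T U) UT andbT.
by apply/fsubsetP => x; rewrite in_fset2 => /orP[]/eqP->.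
Qed.

Definition Gla (n : nat) (la : intpart n) : scgraph n tableau :=
  SCGraph (fun T => signature n (rword T)) (@tab_edges_pair n la).

Definition union_vert (n : nat) : {fset tableau} :=
  (\bigcup_(la <- enum {: intpart n}) vert (Gla la))%fset.

Definition union_edges (n i : nat) : {fset {fset tableau}} :=
  (\bigcup_(la <- enum {: intpart n}) edges (Gla la) i)%fset.

Lemma union_edges_pair (n i : nat) e :
  e \in union_edges n i -> (e `<=` union_vert n) && (#|` e| == 2).
Proof.
case/bigfcupP => la lan /edges_pair /andP[sub ->]; rewrite andbT.
by apply: fsubset_trans sub _; apply: bigfcup_sup; rewrite ?mem_enum.
Qed.

Definition Gunion (n : nat) : scgraph n tableau :=
  SCGraph (fun T => signature n (rword T)) (@union_edges_pair n).

(* The variables are indexed by 0, 1, 2, ... and a series is given by its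
   coefficients. *)
Definition fps := {cmonom nat} -> int.

Definition monomial (s : seq nat) : {cmonom nat} :=
  \big[mmul/mone]_(k <- s) ucm k.

(* The sum of x_(s_1) ... x_(s_n) over all sequences s of n indices that
   satisfy A.  Those contributing to the coefficient of m only use indices
   in the support of m, so that the count below is over a finite type. *)
Definition genfun (n : nat) (A : pred (seq nat)) : fps := fun m =>
  Posz #|[set t : n.-tuple (finsupp m) |
           A (map val t) & monomial (map val t) == m]|.

Definition fundF (n : nat) (s : signs n) : fps :=
  genfun n (fun t => sorted leq t &&
    [forall j : 'I_n.-1, (nth 0 t j == nth 0 t j.+1) ==> tnth s j]).

(* The generating function of semistandard fillings of la; a filling is
   encoded by the sequence of its n entries. *)
Definition schur (n : nat) (la : intpart n) : fps :=
  genfun n (fun t => is_ssyt (reshape la t)).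

(* Main.v *)
Require Import Defs.
From mathcomp Require Import zify.
From Stdlib Require Import Relation_Operators FunctionalExtensionality.

(* Knuth moves preserve the signature and commute with d_i up to Knuth
   equivalence, and a word is Knuth equivalent to the reading word of its
   insertion tableau; hence P preserves signatures and P (d_i w) = d_i (P w),
   which makes P a morphism.  The matchings E_i then give bijections between
   the fibers of P over T and over d_i T.  All fibers over SYT(la) have the same
   cardinality because SYT(la) is connected under the d_i: a d_i on w is a Knuth
   move on the inverse permutation, and the inverses of the reading words of the
   tableaux of shape la all have the same insertion tableau.  It remains to
   expand s_la as the sum of F_sigma(T) over SYT(la), by standardization. *)

Set Implicit Arguments.
Unset Strict Implicit.
Unset Printing Implicit Defensive.

Import GRing.Theory.
Local Open Scope nat_scope.

(** * Row insertion and Knuth moves *)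

(** The hypothesis on the matchings fixes the neighbour of a permutation only up to Knuth
    equivalence, so along an edge nothing but the insertion tableau can be followed; counting fibers
    is what this still allows. Matching injects the fiber over T into the fiber over d_i T, and
    since d_i is an involution, exchanging the roles of the two tableaux gives equality. The common
    insertion tableau of the inverses is computed directly, not through the symmetry of the
    Robinson-Schensted correspondence. The inverse of the reading word of T lists the reading
    positions of the cells that hold 1, 2, ..., n. These cells build up the diagram of la one by
    one, and inserting labels that increase in the reading order yields a tableau that depends on
    the final diagram alone, not on the order in which it grew. *)

Fixpoint rowins (r : seq nat) (x : nat) : seq nat * seq nat :=
  if r is a :: r' then
    if x < a then (x :: r', [:: a])
    else (a :: (rowins r' x).1, (rowins r' x).2)
  else ([:: x], [::]).

(** All bumped letters are collected into the word that the next row receives. Inserting a whole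
    word row by row, not letter by letter, reduces invariance under Knuth moves to a statement about
    a single row. *)
Fixpoint rowinsw (r w : seq nat) : seq nat * seq nat :=
  if w is x :: w' then
    ((rowinsw (rowins r x).1 w').1,
     (rowins r x).2 ++ (rowinsw (rowins r x).1 w').2)
  else (r, [::]).

Lemma insert_cons r T x :
  insert (r :: T) x = (rowins r x).1 :: foldl insert T (rowins r x).2.
Proof.
suff: ((rowins r x).1, (rowins r x).2) =
    if find (fun y => x < y) r < size r
    then (set_nth 0 r (find (fun y => x < y) r) x,
          [:: nth 0 r (find (fun y => x < y) r)])
    else (rcons r x, [::]).
  by rewrite /=; case: ifP => _ [-> ->].
elim: r => //= a r IH; case: ltnP => //= _; rewrite ltnS.
by move: IH; case: ifP => _ [-> ->].
Qed.

Lemma foldl_insert_cons r T w :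
  foldl insert (r :: T) w =
  (rowinsw r w).1 :: foldl insert T (rowinsw r w).2.
Proof.
elim: w r T => //= x w IH r T.
by have /= -> := insert_cons r T x; rewrite IH foldl_cat.
Qed.

(** A nonempty word may start from one empty row, so that [foldl_insert_cons] applies; for the empty
    word the two starts differ. *)
Lemma foldl_insert_nil x w : Ptab (x :: w) = foldl insert [:: [::]] (x :: w).
Proof. by []. Qed.

Lemma rowinsw_cat r u v :
  rowinsw r (u ++ v) = ((rowinsw (rowinsw r u).1 v).1,
                        (rowinsw r u).2 ++ (rowinsw (rowinsw r u).1 v).2).
Proof.
elim: u r => [|x u IH] r /=; first by case: (rowinsw r v).
by rewrite IH /= catA.
Qed.

Lemma rowins_mem r x : {subset (rowins r x).1 <= x :: r}.
Proof.
elim: r => //= a r IH; case: ltnP => _ y; rewrite !inE => /orP[->|] //.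
- by move=> ->; rewrite !orbT.
- by rewrite orbT.
by move/IH; rewrite inE => /orP[->|->]; rewrite ?orbT.
Qed.

Lemma rowins_bumped_mem r x : {subset (rowins r x).2 <= r}.
Proof.
elim: r => //= a r IH; case: ltnP => _ y; rewrite !inE; first by move->.
by move/IH ->; rewrite orbT.
Qed.

Lemma rowins_path a r x : a <= x -> path leq a r -> path leq a (rowins r x).1.
Proof.
elim: r a => [|b r IH] a /= ax; first by rewrite ax.
case/andP=> ab pr; case: ltnP => xb /=.
  by rewrite ax (path_le leq_trans (ltnW xb) pr).
by rewrite ab IH.
Qed.

Lemma rowins_sorted r x : sorted leq r -> sorted leq (rowins r x).1.
Proof.
case: r => //= a r pr; case: ltnP => xa /=.
  exact: (path_le leq_trans (ltnW xa) pr).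
exact: rowins_path.
Qed.

Lemma rowinsw_sorted r w : sorted leq r -> sorted leq (rowinsw r w).1.
Proof. by elim: w r => //= x w IH r /rowins_sorted-/(_ x)/IH. Qed.

Variant rowins_spec (r : seq nat) (x : nat) : seq nat * seq nat -> Prop :=
| RowAppend of all (geq x) r : rowins_spec r x (rcons r x, [::])
| RowBump A b B of r = A ++ b :: B & all (geq x) A & x < b :
    rowins_spec r x (A ++ x :: B, [:: b]).

Lemma rowinsP r x : rowins_spec r x (rowins r x).
Proof.
elim: r => [|a r IH] /=; first exact: (@RowAppend [::]).
case: ltnP => [xa|ax]; first exact: (@RowBump _ _ [::]).
case: IH => [al|A b B -> al xb] /=.
  by rewrite -rcons_cons; apply: RowAppend; rewrite /= ax.
by rewrite -cat_cons; apply: (@RowBump _ _ (a :: A)); rewrite //= ax.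
Qed.

Lemma rowins_catl A r x : all (geq x) A ->
  rowins (A ++ r) x = (A ++ (rowins r x).1, (rowins r x).2).
Proof.
elim: A => [|a A IH] /=; first by case: (rowins r x).
by case/andP=> ax /IH ->; rewrite ltnNge ax.
Qed.

(** Of two equal letters the left one counts as smaller, which explains where the inequalities are
    weak. *)
Inductive knuth1 : seq nat -> seq nat -> Prop :=
| Knuth_yxz A B x y z of x < y <= z :
    knuth1 (A ++ [:: y; x; z] ++ B) (A ++ [:: y; z; x] ++ B)
| Knuth_xzy A B x y z of x <= y < z :
    knuth1 (A ++ [:: x; z; y] ++ B) (A ++ [:: z; x; y] ++ B).

Definition knuth := clos_refl_sym_trans _ knuth1.

Lemma knuth1_cat C D u v : knuth1 u v -> knuth1 (C ++ u ++ D) (C ++ v ++ D).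
Proof.
case=> A B x y z h; rewrite -!(catA A) !(catA C) -!(catA _ B).
  exact: Knuth_yxz.
exact: Knuth_xzy.
Qed.

Lemma knuth_refl u : knuth u u. Proof. exact: rst_refl. Qed.

Lemma knuth_trans u v w : knuth u v -> knuth v w -> knuth u w.
Proof. exact: rst_trans. Qed.

Lemma knuth_sym u v : knuth u v -> knuth v u. Proof. exact: rst_sym. Qed.

Lemma knuth_cat C D u v : knuth u v -> knuth (C ++ u ++ D) (C ++ v ++ D).
Proof.
elim=> {u v} [u v /(knuth1_cat C D)|u|u v _|u v w _ + _].
- exact: rst_step.
- exact: rst_refl.
- exact: rst_sym.
exact: rst_trans.
Qed.

Lemma knuth_catl C u v : knuth u v -> knuth (C ++ u) (C ++ v).
Proof. by move/(knuth_cat C [::]); rewrite !cats0. Qed.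

Lemma knuth_catr D u v : knuth u v -> knuth (u ++ D) (v ++ D).
Proof. exact: (knuth_cat [::]). Qed.

Lemma knuth_yxz x y z : x < y <= z -> knuth [:: y; x; z] [:: y; z; x].
Proof. by move=> h; apply/rst_step/(Knuth_yxz [::] [::]). Qed.

Lemma knuth_xzy x y z : x <= y < z -> knuth [:: x; z; y] [:: z; x; y].
Proof. by move=> h; apply/rst_step/(Knuth_xzy [::] [::]). Qed.

(** The new letter travels left over the larger letters by [yxz] moves until it stands just after
    the letter it bumps; that letter then travels to the front over the smaller ones by [xzy]
    moves. *)
Lemma rowins_knuth r x : sorted leq r ->
  knuth (rcons r x) ((rowins r x).2 ++ (rowins r x).1).
Proof.
elim: r => [|a r IH] /= sr; first exact: knuth_refl.
case: ltnP => [xa|ax] /=.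
  elim/last_ind: r sr {IH} => [|r d IH] /= sr; first exact: knuth_refl.
  move: sr; rewrite rcons_path => /andP[sr lad]; rewrite -cats1.
  have {}IH := knuth_catr [:: d] (IH sr); rewrite /= !cats1 in IH.
  apply: knuth_trans IH.
  have ->: a :: rcons r d ++ [:: x] = belast a r ++ [:: last a r; d; x].
    by rewrite -cats1 -catA -cat_cons lastI -cats1 -catA.
  have ->: a :: rcons (rcons r x) d = belast a r ++ [:: last a r; x; d].
    by rewrite -!cats1 -catA -cat_cons lastI -cats1 -catA.
  apply/knuth_catl/knuth_sym/knuth_yxz; rewrite lad andbT.
  apply: leq_trans xa _.
  have := order_path_min leq_trans sr; move/allP => h.
  by have := mem_last a r; rewrite inE => /orP[/eqP ->|/h].
apply: (knuth_trans (knuth_catl [:: a] (IH (path_sorted sr)))) => /=.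
move: sr ax; case: rowinsP => [_ _ _|A b B -> hA xb] /=; first exact: knuth_refl.
case: A hA => [_|c A /=/andP[cx hA]] /=.
  move=> /andP[ab _] ax.
  by apply: (knuth_catr B (@knuth_xzy a x b _)); rewrite ax.
case/andP=> ac _ ax.
by apply: (knuth_catr (A ++ x :: B) (@knuth_xzy a c b _)); rewrite ac (leq_ltn_trans cx).
Qed.

Lemma rword_cons r T : rword (r :: T) = rword T ++ r.
Proof. by rewrite /rword rev_cons flatten_rcons. Qed.

Lemma rowins_bumped_size r x : size (rowins r x).2 <= 1.
Proof. by case: rowinsP. Qed.

Lemma insert_sorted T x : all (sorted leq) T -> all (sorted leq) (insert T x).
Proof.
elim: T x => [|r T IH] // x; rewrite insert_cons /= => /andP[sr sT].
rewrite rowins_sorted //=; have := rowins_bumped_size r x.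
by case: (rowins r x).2 => [|b [|]] //= _; apply: IH.
Qed.

Lemma Ptab_rcons w x : Ptab (rcons w x) = insert (Ptab w) x.
Proof. by rewrite /Ptab foldl_rcons. Qed.

Lemma Ptab_row_sorted w : all (sorted leq) (Ptab w).
Proof. by elim/last_ind: w => // w x /insert_sorted; rewrite Ptab_rcons. Qed.

Lemma insert_knuth T x : all (sorted leq) T ->
  knuth (rcons (rword T) x) (rword (insert T x)).
Proof.
elim: T x => [|r T IH] x; first by move=> _; apply: knuth_refl.
rewrite insert_cons /= => /andP[sr sT]; rewrite !rword_cons rcons_cat.
apply: knuth_trans (knuth_catl _ (rowins_knuth x sr)) _.
rewrite catA; apply: knuth_catr; have := rowins_bumped_size r x.
case: (rowins r x).2 => [|b [|]] //= _; first by rewrite cats0; apply: knuth_refl.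
by rewrite cats1; apply: IH.
Qed.

Lemma knuth_Ptab w : knuth w (rword (Ptab w)).
Proof.
elim/last_ind: w => [|w x IH]; first exact: knuth_refl.
rewrite Ptab_rcons; apply: knuth_trans (insert_knuth _ (Ptab_row_sorted w)).
by rewrite -!cats1; apply: knuth_catr.
Qed.

Lemma rowins_bumped_le r y z y' z' : sorted leq r -> y <= z ->
  (rowins r y).2 = [:: y'] -> (rowins (rowins r y).1 z).2 = [:: z'] -> y' <= z'.
Proof.
elim: r => //= a r IH sr yz; case: ltnP => ya /=.
  case: (ltnP z y) => [|_ /= [<-]]; first by rewrite ltnNge yz.
  have := order_path_min leq_trans sr => /allP h e; apply: h.
  by apply: (@rowins_bumped_mem r z); rewrite e inE.
rewrite ltnNge (leq_trans ya yz) /=; exact: IH (path_sorted sr) yz.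
Qed.

Lemma rowins_bumped_nil r y z : y <= z ->
  (rowins r y).2 = [::] -> (rowins (rowins r y).1 z).2 = [::].
Proof.
elim: r => [|a r IH] /= yz; first by rewrite ltnNge yz.
case: ltnP => //= ya; rewrite ltnNge (leq_trans ya yz) /=; exact: IH.
Qed.

Lemma rowins_bumped_gt r x : all (ltn x) (rowins r x).2.
Proof. by case: rowinsP => //= A b B _ _ ->. Qed.

(** When [y] arrives, [z] is in the row, so [y] bumps some letter, at the latest [z]. *)
Lemma rowins_bump_smaller r z y : sorted leq r -> y < z ->
  exists2 y', (rowins (rowins r z).1 y).2 = [:: y'] & y' <= z.
Proof.
move=> sr yz; elim: r sr => [|a r IH] /= sr; first by rewrite yz; exists z.
case: ltnP => za /=; first by rewrite yz; exists z.
case: ltnP => ya /=; first by exists a.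
exact: IH (path_sorted sr).
Qed.

(** The two words bumped by the sides of a Knuth move are related in this way, so the next row faces
    the same situation. Both directions are needed: see the proof of [rowinsw_xzy]. *)
Variant knuth1_eq (u v : seq nat) : Prop :=
| Knuth_eq of u = v | Knuth_lr of knuth1 u v | Knuth_rl of knuth1 v u.

(** At the first entry [a] exceeding [x], the bumped words are [a y z'] and [a z' y] if also
    [y < a], and [y' a z'] and [y' z' a] otherwise. Both pairs are [yxz] moves again, and they
    become equal when [z] bumps nothing. *)
Lemma rowinsw_yxz r x y z : sorted leq r -> x < y <= z ->
  (rowinsw r [:: y; x; z]).1 = (rowinsw r [:: y; z; x]).1 /\
  knuth1_eq (rowinsw r [:: y; x; z]).2 (rowinsw r [:: y; z; x]).2.
Proof.
move=> sr /andP[xy yz]; have xz := leq_trans xy yz.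
rewrite /= !cats0; elim: r sr => [|a r IH] /= sr.
  by rewrite xy [z < y]ltnNge yz /= xy [z < x]ltnNge (ltnW xz); split=> //; apply: Knuth_eq.
have hr := allP (order_path_min leq_trans sr).
case: (ltnP y a) => ya /=.
  rewrite xy [z < y]ltnNge yz /= [z < x]ltnNge (ltnW xz) /= xy /=; split=> //.
  have := @rowins_bumped_mem r z; have := rowins_bumped_size r z.
  case: (rowins r z).2 => [|z' [|]] //= _; first by move=> _; apply: Knuth_eq.
  move/(_ z'); rewrite inE eqxx => /(_ isT) /hr az'.
  by apply: Knuth_lr; apply: (@Knuth_yxz [::] [::]); rewrite ya.
rewrite [z < a]ltnNge (leq_trans ya yz) /=; case: (ltnP x a) => xa /=.
  rewrite [z < x]ltnNge (ltnW xz) /=; split=> //.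
  have := @rowins_bumped_le r y z; have := @rowins_bumped_nil r y z yz.
  have := rowins_bumped_size (rowins r y).1 z.
  have := rowins_bumped_size r y; have := rowins_bumped_gt r y.
  case: (rowins r y).2 => [|y' [|]] //= => [_ _ _ -> // _|/andP[yy' _] _ + _].
    exact: Knuth_eq.
  case: (rowins (rowins r y).1 z).2 => [|z' [|]] //= _; first by move=> _; apply: Knuth_eq.
  move=> /(_ _ _ (path_sorted sr) yz erefl erefl) h; apply: Knuth_lr.
  by apply: (@Knuth_yxz [::] [::]); rewrite h (leq_ltn_trans ya).
have [h1 h2] := IH (path_sorted sr).
rewrite ltnNge (leq_trans ya yz) /=; split=> //; first by rewrite h1.
Qed.

Lemma rowinsw_xzy r x y z : sorted leq r -> x <= y < z ->
  (rowinsw r [:: x; z; y]).1 = (rowinsw r [:: z; x; y]).1 /\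
  knuth1_eq (rowinsw r [:: x; z; y]).2 (rowinsw r [:: z; x; y]).2.
Proof.
move=> sr /andP[xy yz]; have xz := leq_ltn_trans xy yz.
rewrite /= !cats0; elim: r sr => [|a r IH] /= sr.
  by rewrite xz [z < x]ltnNge (ltnW xz) /= [y < x]ltnNge xy /= yz; split=> //; apply: Knuth_eq.
have hr := allP (order_path_min leq_trans sr); have sr' := path_sorted sr.
case: (ltnP z a) => za /=.
  rewrite xz (ltn_trans xz za) /= [z < x]ltnNge (ltnW xz) /= [y < x]ltnNge xy /=.
  case: r {IH sr sr'} hr => [|u r] hr /=; first by rewrite yz; split=> //; apply: Knuth_eq.
  (* The bumped words are [a u z] and [a z u]: the move changes its type to [yxz] and its
     direction. *)
  have au : a <= u by apply: hr; rewrite inE eqxx.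
  have zu := leq_trans za au.
  rewrite zu /= yz (ltn_trans yz zu) /=; split=> //.
  by apply: Knuth_rl; apply: (@Knuth_yxz [::] [::]); rewrite za au.
case: (ltnP x a) => xa /=.
  rewrite [z < x]ltnNge (ltnW xz) /= [y < x]ltnNge xy /=; split=> //.
  have := @rowins_bump_smaller r z y sr' yz => -[y' e y'z]; rewrite e.
  have ay' : a <= y'.
    have := @rowins_bumped_mem (rowins r z).1 y y'.
    rewrite e inE eqxx => /(_ isT)/rowins_mem; rewrite inE => /orP[/eqP ->//|].
    exact: hr.
  have := rowins_bumped_gt r z; have := rowins_bumped_size r z.
  case: (rowins r z).2 => [|z' [|]] //= _; first by move=> _; apply: Knuth_eq.
  case/andP=> zz' _; apply: Knuth_lr; apply: (@Knuth_xzy [::] [::]).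
  by rewrite ay' (leq_ltn_trans y'z).
have [h1 h2] := IH sr'; rewrite [z < a]ltnNge za /= [y < a]ltnNge (leq_trans xa xy) /=.
by split=> //; first by rewrite h1.
Qed.

Lemma rowinsw_knuth1 r u v : sorted leq r -> knuth1 u v ->
  (rowinsw r u).1 = (rowinsw r v).1 /\
  knuth1_eq (rowinsw r u).2 (rowinsw r v).2.
Proof.
move=> sr uv; have [A [B [u' [v' [-> ->]]]]] : exists A B u' v',
    [/\ u = A ++ u' ++ B, v = A ++ v' ++ B & forall s, sorted leq s ->
      (rowinsw s u').1 = (rowinsw s v').1 /\
      knuth1_eq (rowinsw s u').2 (rowinsw s v').2].
  by case: uv => A B x y z h; exists A, B; do 2!eexists; split=> // s ss;
    [apply: rowinsw_yxz | apply: rowinsw_xzy].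
move/(_ _ (rowinsw_sorted A sr)) => [e h].
rewrite !rowinsw_cat /= !e; split=> //.
case: h => [-> |/knuth1_cat h|/knuth1_cat h]; first exact: Knuth_eq.
  by apply: Knuth_lr; apply: h.
by apply: Knuth_rl; apply: h.
Qed.

Lemma rowinsw_bumped_size r w : size (rowinsw r w).2 <= size w.
Proof.
elim: w r => //= x w IH r; rewrite size_cat -add1n.
exact: leq_add (rowins_bumped_size r x) (IH _).
Qed.

Lemma knuth1_size u v : knuth1 u v -> size u = size v.
Proof. by case=> *; rewrite !size_cat. Qed.

Lemma knuth1_size_gt2 u v : knuth1 u v -> 2 < size u.
Proof. by case=> *; rewrite !size_cat /=; lia. Qed.

Lemma knuth1_foldl_insert T u v : all (sorted leq) T -> knuth1 u v ->
  foldl insert T u = foldl insert T v.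
Proof.
have step r T' u' v' : sorted leq r -> knuth1 u' v' ->
    (forall u v, size u <= size (rowinsw r u').2 -> knuth1 u v ->
       foldl insert T' u = foldl insert T' v) ->
    foldl insert (r :: T') u' = foldl insert (r :: T') v'.
  move=> sr uv IH; rewrite !foldl_insert_cons.
  have [-> [->|h|h]] := rowinsw_knuth1 sr uv; first by [].
    by rewrite (IH _ _ _ h).
  by rewrite -(IH _ _ _ h) // (knuth1_size h).
(* The empty tableau behaves as a single empty row, into which the first letter
   goes without bumping: the bumped words get shorter. *)
have nil m w1 w2 : size w1 <= m -> knuth1 w1 w2 ->
    foldl insert [::] w1 = foldl insert [::] w2.
  elim: m w1 w2 => [|m IH] w1 w2 sz k.
    by have := knuth1_size_gt2 k; lia.
  have := knuth1_size k.
  case: w1 w2 sz k => [|x w1] [|y w2] sz k // _;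
  apply: (step [::] [::] _ _ isT k) => u' v' sz'.
  apply: (IH _ _ (leq_trans sz' _)).
  exact: leq_trans (rowinsw_bumped_size [:: x] w1) sz.
elim: T u v => [|r T IH] u v; first by move=> _; apply: nil (leqnn _).
by case/andP=> sr sT uv; apply: step => // *; apply: IH.
Qed.

Lemma Ptab_knuth u v : knuth u v -> Ptab u = Ptab v.
Proof.
by elim=> {u v} [u v|//|//|u v w _ -> //]; apply: knuth1_foldl_insert.
Qed.

(** * Insertion tableaux *)

Lemma col_strictP lower upper :
  reflect (size upper <= size lower /\
           forall j, j < size upper -> nth 0 lower j < nth 0 upper j)
          (col_strict lower upper).
Proof.
apply: (iffP andP) => -[-> h]; split=> //.
  by move=> j ju; have /forallP/(_ (Ordinal ju)) := h.
by apply/forallP => j; apply: h.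
Qed.

Lemma col_strict0 r : col_strict r [::].
Proof. by apply/col_strictP. Qed.

Lemma col_strict_cons a r c s :
  col_strict (a :: r) (c :: s) = (a < c) && col_strict r s.
Proof.
apply/col_strictP/andP => [[sz h]|[ac /col_strictP[sz h]]].
  split; first exact: (h 0).
  by apply/col_strictP; split=> // j js; apply: (h j.+1).
by split=> // -[|j] //=; apply: h.
Qed.

Lemma col_strict_rowins_l r s x :
  col_strict r s -> col_strict (rowins r x).1 s.
Proof.
elim: r s => [|a r IH] [|c s] //=; rewrite ?col_strict0 //.
rewrite col_strict_cons => /andP[ac rs]; case: ltnP => xa /=.
  by rewrite col_strict_cons (ltn_trans xa).
by rewrite col_strict_cons ac IH.
Qed.

(** The bumped letter [b] enters the upper row weakly to the left of the column it leaves, because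
    the entry above its old place is larger. In its new column the lower entry is now at most [x],
    hence less than [b]. *)
Lemma col_strict_rowins r s x b : sorted leq r -> sorted leq s ->
  col_strict r s -> (rowins r x).2 = [:: b] ->
  col_strict (rowins r x).1 (rowins s b).1.
Proof.
elim: r s => [|a r IH] //= s sr ss rs.
have ha := allP (order_path_min leq_trans sr).
case: ltnP => xa /=.
  case=> <-; case: s rs ss => [|c s].
    by move=> _ _; rewrite /= col_strict_cons xa col_strict0.
  by rewrite col_strict_cons => /andP[ac rs _] /=; rewrite ac /= col_strict_cons xa.
move=> e; have ab : a < b.
  by apply: leq_ltn_trans xa _; have := rowins_bumped_gt r x; rewrite e /= andbT.
case: s rs ss => [|c s]; first by move=> _ _; rewrite /= col_strict_cons ab col_strict0.
rewrite col_strict_cons => /andP[ac rs] /= ss; case: ltnP => bc /=.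
  by rewrite col_strict_cons ab col_strict_rowins_l.
by rewrite col_strict_cons ac IH // (path_sorted sr, path_sorted ss).
Qed.

Lemma insert_ssyt T x : is_ssyt T -> is_ssyt (insert T x).
Proof.
move=> /andP[sT cT]; rewrite /is_ssyt insert_sorted //=.
elim: T x sT cT => [|r T IH] x //; rewrite insert_cons /= => /andP[sr sT] cT.
have /IH := sT => /(_ _ (path_sorted cT)); have := rowins_bumped_size r x.
case e: (rowins r x).2 => [|b [|]] //= _.
  by case: T cT {sT IH} => //= s T /andP[rs ->]; rewrite col_strict_rowins_l.
case: T cT sT {IH} => [|s T] /=.
  move=> _ _ _; rewrite andbT; have := @col_strict_rowins r [::] x b sr isT.
  by rewrite col_strict0 /=; apply.
case/andP=> rs _ /andP[ss sT] /(_ b).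
have /= -> := insert_cons s T b => /= ->.
by rewrite (col_strict_rowins sr ss rs e).
Qed.

Lemma Ptab_ssyt w : is_ssyt (Ptab w).
Proof. by elim/last_ind: w => // w x; rewrite Ptab_rcons; apply: insert_ssyt. Qed.

Lemma knuth_perm u v : knuth u v -> perm_eq u v.
Proof.
elim=> {u v} [u v|//|u v _|u v w _ + _].
- case=> A B x y z _; rewrite perm_cat2l perm_cat2r.
    by rewrite (perm_cat2l [:: y] [:: x; z] [:: z; x]) (perm_catC [:: x]).
  by rewrite (perm_cat2r [:: y] [:: x; z] [:: z; x]) (perm_catC [:: x]).
- by rewrite perm_sym.
exact: perm_trans.
Qed.

Lemma perm_rword T : perm_eq (rword T) (flatten T).
Proof. by rewrite /rword perm_flatten // perm_rev. Qed.

Lemma perm_Ptab w : perm_eq (flatten (Ptab w)) w.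
Proof.
rewrite -(permPl (perm_rword _)) perm_sym; exact: knuth_perm (knuth_Ptab w).
Qed.

Lemma rowins_neq0 r x : (rowins r x).1 != [::].
Proof. by case: rowinsP => [_|A b B _ _ _]; [case: r|case: A]. Qed.

Lemma insert_neq0 T x : [::] \notin T -> [::] \notin insert T x.
Proof.
elim: T x => [|r T IH] x //; rewrite insert_cons !inE !negb_or => /andP[_ T0].
rewrite eq_sym rowins_neq0 /=; have := rowins_bumped_size r x.
by case: (rowins r x).2 => [|b [|]] //= _; apply: IH.
Qed.

Lemma Ptab_neq0 w : [::] \notin Ptab w.
Proof. by elim/last_ind: w => // w x; rewrite Ptab_rcons; apply: insert_neq0. Qed.

Lemma sorted_ltn_uniq r : uniq r -> sorted leq r -> sorted ltn r.
Proof. by rewrite ltn_sorted_uniq_leq => -> ->. Qed.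

Lemma uniq_row (T : tableau) r : r \in T -> uniq (flatten T) -> uniq r.
Proof.
elim: T => //= s T IH; rewrite inE cat_uniq => /orP[/eqP->|rT] /and3P[] //.
by move=> _ _; apply: IH.
Qed.

Lemma shape_sorted T : sorted col_strict T -> sorted geq (shape T).
Proof.
rewrite sorted_map; apply: sub_sorted => r s /= /col_strictP[] //.
Qed.

Lemma Ptab_syt n w : perm_eq w (iota 1 n) ->
  exists la : intpart n, Ptab w \in SYT la.
Proof.
move=> pw; have [sT cT] := andP (Ptab_ssyt w).
have pT : perm_eq (flatten (Ptab w)) (iota 1 n).
  exact: perm_trans (perm_Ptab w) pw.
have h : is_intpart n (shape (Ptab w)).
  rewrite /is_intpart shape_sorted //= -size_flatten (perm_size pT) size_iota eqxx.
  rewrite andbT; apply/mapP => -[r rT] /esym/size0nil r0.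
  by have := Ptab_neq0 w; rewrite -r0 rT.
exists (Intpart h); rewrite in_SYT /is_syt eqxx pT cT !andbT /=.
apply/allP => r rT; apply: sorted_ltn_uniq; last exact: (allP sT).
by apply: uniq_row rT _; rewrite (perm_uniq pT) iota_uniq.
Qed.

Lemma rowinsw_cons a r w : all (leq a) w ->
  rowinsw (a :: r) w = (a :: (rowinsw r w).1, (rowinsw r w).2).
Proof. by elim: w r => //= x w IH r /andP[ax /IH]; rewrite ltnNge ax /= => ->. Qed.

(** Each letter of [r] bumps the letter of [s] in its own column or is appended. Reading a new
    bottom row thus pushes the whole tableau up by one row, which is how [Ptab_rword] recovers a
    tableau. *)
Lemma rowinsw_col_strict r s : sorted leq r -> col_strict r s ->
  rowinsw s r = (r, s).
Proof.
elim: r s => [|a r IH] [|c s] // sr.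
  move=> _ /=; rewrite rowinsw_cons /= ?IH ?col_strict0 ?(path_sorted sr) //.
  exact: order_path_min leq_trans sr.
rewrite col_strict_cons => /andP[ac rs] /=; rewrite ac /= rowinsw_cons /=.
  by rewrite IH // (path_sorted sr).
exact: order_path_min leq_trans sr.
Qed.

Lemma Ptab_rword T : is_ssyt T -> [::] \notin T -> Ptab (rword T) = T.
Proof.
elim: T => //= r T IH /andP[/= /andP[sr sT] cT]; rewrite inE negb_or => /andP[r0 T0].
rewrite rword_cons /Ptab foldl_cat -/(Ptab _) IH //; last first.
  by rewrite /is_ssyt sT (path_sorted cT).
elim: T r r0 sr sT cT T0 {IH} => [|s T IH] r r0 sr.
  case: r r0 sr => // x r _ sr _ _ _; rewrite -/(Ptab (x :: r)) foldl_insert_nil.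
  by rewrite foldl_insert_cons rowinsw_col_strict // col_strict0.
case/andP=> ss sT /= /andP[rs cT]; rewrite inE negb_or => /andP[s0 T0].
by rewrite foldl_insert_cons rowinsw_col_strict //= IH // eq_sym.
Qed.

Lemma Ptab_rword_syt n (la : intpart n) T : T \in SYT la -> Ptab (rword T) = T.
Proof.
rewrite in_SYT => /and4P[/eqP shT _ sT cT]; apply: Ptab_rword.
  rewrite /is_ssyt cT andbT; apply: sub_all sT => r.
  by apply: sub_sorted => x y; apply: ltnW.
apply/negP => T0; case/and3P: (intpartP la) => _ /negP[].
by rewrite -shT -[0]/(size (Nil nat)) map_f.
Qed.

(** * Knuth moves and the maps d_i *)

(** Strictness gives [x.+1 < z] for the two exchanged letters, so a move never reverses two
    consecutive values; this is what keeps the signature. *)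
Inductive sknuth1 : seq nat -> seq nat -> Prop :=
| Sknuth_yxz A B x y z of x < y < z :
    sknuth1 (A ++ [:: y; x; z] ++ B) (A ++ [:: y; z; x] ++ B)
| Sknuth_xzy A B x y z of x < y < z :
    sknuth1 (A ++ [:: x; z; y] ++ B) (A ++ [:: z; x; y] ++ B).

Lemma sknuth1W u v : sknuth1 u v -> knuth1 u v.
Proof.
by case=> A B x y z /andP[xy yz]; constructor; rewrite ?xy ?yz // ltnW.
Qed.

Lemma sknuth1_knuth u v : sknuth1 u v -> knuth u v.
Proof. by move/sknuth1W; apply: rst_step. Qed.

Lemma knuth1_strict u v : uniq u -> knuth1 u v -> sknuth1 u v.
Proof.
move=> + k; case: k => A B x y z h; rewrite cat_uniq => /and3P[_ _] /=;
  rewrite !inE !negb_or => /andP[/and3P[n1 n2 _] /andP[/andP[n3 _] _]];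
  constructor; lia.
Qed.

Lemma index_swap A B (p q a b : nat) : p != q -> ~~ ((a == p) && (b == q)) ->
  ~~ ((a == q) && (b == p)) ->
  (index a (A ++ [:: p; q] ++ B) < index b (A ++ [:: p; q] ++ B)) =
  (index a (A ++ [:: q; p] ++ B) < index b (A ++ [:: q; p] ++ B)).
Proof.
move=> pq; rewrite !index_cat /= !inE.
case aA: (a \in A); case bA: (b \in A) => //.
- by rewrite -index_mem in aA; move=> _ _; rewrite !ltn_addr.
- rewrite -index_mem in bA; move=> _ _.
  by rewrite !(leq_gtF (leq_trans (ltnW bA) (leq_addr _ _))).
by rewrite !ltn_add2l; do !case: eqP => //; lia.
Qed.

Lemma sknuth1_before u v a b : sknuth1 u v -> a <= b.+1 -> b <= a.+1 ->
  (index a u < index b u) = (index a v < index b v).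
Proof.
case=> A B x y z h ab ba.
  have := @index_swap (A ++ [:: y]) B x z a b.
  by rewrite -!catA; apply; lia.
by apply: (@index_swap A (y :: B)); lia.
Qed.

Lemma sknuth1_perm u v : sknuth1 u v -> perm_eq u v.
Proof. by move/sknuth1_knuth/knuth_perm. Qed.

Lemma sknuth1_uniq u v : uniq u -> sknuth1 u v -> uniq v.
Proof.
by move=> uu /sknuth1_perm/perm_uniq <-.
Qed.

Lemma knuth_uniq u v : uniq u -> knuth u v -> uniq v.
Proof. by move=> uu /knuth_perm /perm_uniq <-. Qed.

Lemma knuth_signature n u v : uniq u -> knuth u v -> signature n u = signature n v.
Proof.
move=> + k; elim: k => {u v} [u v k|//|u v k IH|u v w k IH k' IH'] uu.
- apply: eq_from_tnth => j; rewrite !tnth_mktuple.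
  by apply: (sknuth1_before (knuth1_strict uu k)); lia.
- by rewrite IH //; apply: knuth_uniq uu (knuth_sym k).
by rewrite IH // IH' //; apply: knuth_uniq uu k.
Qed.

Definition swp (a b x : nat) := if x == a then b else if x == b then a else x.

Lemma swpK a b : involutive (swp a b).
Proof. by move=> x; rewrite /swp; do !case: eqP => //; lia. Qed.

Lemma index_swp a b x w : index x (map (swp a b) w) = index (swp a b x) w.
Proof.
by rewrite -{1}[x](swpK a b) index_map //; apply: can_inj (swpK a b).
Qed.

Lemma swp_l a b : swp a b a = b. Proof. by rewrite /swp eqxx. Qed.

Lemma swp_r a b : swp a b b = a.
Proof. by rewrite /swp eqxx; case: eqP. Qed.

Lemma swp_id a b x : x != a -> x != b -> swp a b x = x.
Proof. by rewrite /swp => /negPf-> /negPf->. Qed.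

Lemma swp_lt a x y : x < y -> (x, y) <> (a, a.+1) -> swp a a.+1 x < swp a a.+1 y.
Proof.
move=> xy ne; have : ~ (x = a /\ y = a.+1) by case=> *; apply: ne; congr pair.
by rewrite /swp; do !case: eqP => //; lia.
Qed.

(** Here [i] is [k.+1], which avoids subtraction. [DwordHi] is the case with [k] in the middle,
    [DwordLo] the case with [k.+2] in the middle. *)
Variant dword_spec (k : nat) (w : seq nat) : seq nat -> Prop :=
| DwordId of between (index k w) (index k.+1 w) (index k.+2 w) :
    dword_spec k w w
| DwordHi of between (index k.+1 w) (index k w) (index k.+2 w) :
    dword_spec k w (map (swp k.+1 k.+2) w)
| DwordLo of between (index k w) (index k.+2 w) (index k.+1 w) :
    dword_spec k w (map (swp k k.+1) w).

Definition has3 k (w : seq nat) := [&& k \in w, k.+1 \in w & k.+2 \in w].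

Lemma index_neq (w : seq nat) a b : a \in w -> a <> b -> index a w <> index b w.
Proof.
move=> aw ab e; apply: ab; rewrite -[a](nth_index 0 aw) e nth_index //.
by rewrite -index_mem -e index_mem.
Qed.

Lemma dwordP k w : has3 k w -> dword_spec k w (dword k.+1 w).
Proof.
case/and3P=> h0 h1 h2.
have := @index_neq w k k.+1 h0; have := @index_neq w k k.+2 h0.
have := @index_neq w k.+1 k.+2 h1.
move=> /(_ ltac:(lia)) n1 /(_ ltac:(lia)) n2 /(_ ltac:(lia)) n3.
rewrite /dword /=; case: ifP => [|/negbT] b1; first exact: DwordId.
case: ifP => [|/negbT] b2; first exact: DwordHi.
by apply: DwordLo; move: b1 b2; rewrite /between; lia.
Qed.

Lemma sknuth1_has3 k u v : sknuth1 u v -> has3 k u = has3 k v.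
Proof. by move/sknuth1_perm/perm_mem => e; rewrite /has3 !e. Qed.

Lemma index_next (A B : seq nat) p q : uniq (A ++ [:: p; q] ++ B) ->
  index q (A ++ [:: p; q] ++ B) = (index p (A ++ [:: p; q] ++ B)).+1.
Proof.
rewrite cat_uniq => /and3P[_ /hasPn h /= /andP[]]; rewrite inE negb_or.
case/andP=> pq _ _; have /= pA := h p (mem_head _ _).
have /= qA : q \notin A by apply: h; rewrite !inE eqxx orbT.
by rewrite !index_cat (negPf pA) (negPf qA) /= eqxx (negPf pq) eqxx addn1 addn0.
Qed.

(* As c lies between a and a+1, these are not adjacent, so they cannot be the
   letters x, y or y, z of the move: the exchange keeps x < y < z. *)
Lemma sknuth1_swp u v a c : uniq u -> sknuth1 u v ->
  between (index a u) (index c u) (index a.+1 u) ->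
  between (index a v) (index c v) (index a.+1 v) ->
  sknuth1 (map (swp a a.+1) u) (map (swp a a.+1) v).
Proof.
move=> uu k; have := sknuth1_uniq uu k; move: uu.
case: k => A B x y z /andP[xy yz] uu uv bu bv; rewrite !map_cat /=;
  constructor; apply/andP; split; apply: swp_lt => // -[? ?]; subst.
- by have := @index_next A (z :: B) _ _ uu; move: bu; rewrite /between /=; lia.
- by have := @index_next A (x :: B) _ _ uv; move: bv; rewrite /between /=; lia.
- have := @index_next (A ++ [:: z]) B a a.+1; rewrite -!catA /= => /(_ uv).
  by move: bv; rewrite /between /=; lia.
have := @index_next (A ++ [:: x]) B a.+1 a; rewrite -!catA /= => /(_ uu).
by move: bu; rewrite /between /=; lia.
Qed.

(** The exchanged letters differ by at least 2. If both lie between [k] and [k.+2], they are these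
    two values, and the third letter of the move is [k.+1]. *)
Lemma sknuth1_far k u v : sknuth1 u v ->
  (forall a b, k <= a <= k.+2 -> k <= b <= k.+2 ->
    (index a u < index b u) = (index a v < index b v)) \/
  exists A B, (u = A ++ [:: k.+1; k; k.+2] ++ B /\ v = A ++ [:: k.+1; k.+2; k] ++ B)
    \/ (u = A ++ [:: k; k.+2; k.+1] ++ B /\ v = A ++ [:: k.+2; k; k.+1] ++ B).
Proof.
case=> A B x y z h.
  have [|/negP ne] := boolP ((x == k) && (z == k.+2)).
    case/andP=> /eqP ex /eqP ez; have ey : y = k.+1 by lia.
    by subst; right; exists A, B; left.
  left=> a b ha hb; have := @index_swap (A ++ [:: y]) B x z a b.
  by rewrite -!catA; apply; lia.
have [|/negP ne] := boolP ((x == k) && (z == k.+2)).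
  case/andP=> /eqP ex /eqP ez; have ey : y = k.+1 by lia.
  by subst; right; exists A, B; right.
by left=> a b ha hb; apply: (@index_swap A (y :: B)); lia.
Qed.

Lemma index3 (A B : seq nat) x y z : uniq (A ++ [:: x; y; z] ++ B) ->
  let w := A ++ [:: x; y; z] ++ B in
  [/\ index x w = size A, index y w = (size A).+1 & index z w = (size A).+2].
Proof.
move=> uw w; have sz : size w = size A + (size B).+3.
  by rewrite /w size_cat /= !addnS.
have nthw i : i < 3 -> nth 0 w (size A + i) = nth 0 [:: x; y; z] i.
  move=> i3; rewrite nth_cat ltnNge leq_addr /= addKn.
  by case: i i3 => [|[|[|]]].
split.
- by rewrite -[X in index X]/(nth 0 [:: x; y; z] 0) -nthw // index_uniq ?sz ?addn0 //; lia.
- by rewrite -[X in index X]/(nth 0 [:: x; y; z] 1) -nthw // index_uniq ?sz ?addn1 //; lia.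
by rewrite -[X in index X]/(nth 0 [:: x; y; z] 2) -nthw // index_uniq ?sz ?addn2 //; lia.
Qed.

Lemma map_swp_id a b (A : seq nat) : a \notin A -> b \notin A -> map (swp a b) A = A.
Proof.
move=> aA bA; rewrite -[RHS]map_id; apply/eq_in_map => x xA.
by rewrite swp_id //; [apply: contraNneq aA => <-|apply: contraNneq bA => <-].
Qed.

Lemma map_swp_cat3 a b (A B : seq nat) x y z : uniq (A ++ [:: x; y; z] ++ B) ->
  a \in [:: x; y; z] -> b \in [:: x; y; z] ->
  map (swp a b) (A ++ [:: x; y; z] ++ B) =
  A ++ [:: swp a b x; swp a b y; swp a b z] ++ B.
Proof.
move=> uw ha hb; have n c : c \in [:: x; y; z] -> (c \notin A) && (c \notin B).
  move=> hc; move: uw; rewrite cat_uniq => /and3P[_ /hasPn hA].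
  rewrite cat_uniq => /and3P[_ /hasPn hB _]; apply/andP; split.
    by apply: hA; rewrite mem_cat hc.
  by apply: contraL hc => /hB.
have /andP[aA aB] := n a ha; have /andP[bA bB] := n b hb.
by rewrite !map_cat /= (map_swp_id aA bA) (map_swp_id aB bB).
Qed.

(** If the order of the three values is the same on both sides, so is the case of d_i, and the move
    survives the exchange. If the move concerns exactly these values, d_i makes different exchanges
    on the two sides and turns a [yxz] move into an [xzy] move, and conversely. *)
Lemma dword_sknuth1 k u v : uniq u -> has3 k u -> sknuth1 u v ->
  knuth (dword k.+1 u) (dword k.+1 v).
Proof.
move=> uu hu k1; have uv := sknuth1_uniq uu k1.
have hv : has3 k v by rewrite -(sknuth1_has3 k k1).
have [same|[A [B [[eu ev]|[eu ev]]]]] := sknuth1_far k k1.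
- have bt a b c : k <= a <= k.+2 -> k <= b <= k.+2 -> k <= c <= k.+2 ->
      between (index a u) (index b u) (index c u) ->
      between (index a v) (index b v) (index c v).
    by move=> ha hb hc; rewrite /between !same.
  case: (dwordP hu) => bu; case: (dwordP hv) => bv;
    move/bt: (bu) => /(_ ltac:(lia) ltac:(lia) ltac:(lia)) bu';
    try (by move: bu' bv; rewrite /between; lia).
  + exact: sknuth1_knuth.
  + exact: sknuth1_knuth (sknuth1_swp uu k1 bu bv).
  exact: sknuth1_knuth (sknuth1_swp uu k1 bu bv).
- rewrite eu ev in uu uv hu hv *.
  have [i1 i2 i3] := index3 uu; have [j1 j2 j3] := index3 uv.
  case: (dwordP hu); rewrite i1 i2 i3 /between ?ltnn; try lia; move=> _.
  case: (dwordP hv); rewrite j1 j2 j3 /between ?ltnn; try lia; move=> _.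
  rewrite !map_swp_cat3 ?inE ?eqxx ?orbT // !swp_l !swp_r !swp_id; try lia.
  by apply/knuth_sym/sknuth1_knuth/Sknuth_xzy; lia.
rewrite eu ev in uu uv hu hv *.
have [i1 i2 i3] := index3 uu; have [j1 j2 j3] := index3 uv.
case: (dwordP hu); rewrite i1 i2 i3 /between ?ltnn; try lia; move=> _.
case: (dwordP hv); rewrite j1 j2 j3 /between ?ltnn; try lia; move=> _.
rewrite !map_swp_cat3 ?inE ?eqxx ?orbT // !swp_l !swp_r !swp_id; try lia.
by apply/knuth_sym/sknuth1_knuth/Sknuth_yxz; lia.
Qed.

Lemma dword_knuth k u v : uniq u -> has3 k u -> knuth u v ->
  knuth (dword k.+1 u) (dword k.+1 v).
Proof.
move=> + + kn; elim: kn => {u v} [u v h|u|u v h IH|u v w h IH h' IH'] uu hu.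
- exact: dword_sknuth1 (knuth1_strict uu h).
- exact: knuth_refl.
- apply/knuth_sym/IH; first exact: knuth_uniq uu (knuth_sym h).
  by rewrite /has3 !(perm_mem (knuth_perm h)).
apply: knuth_trans (IH uu hu) (IH' _ _); first exact: knuth_uniq uu h.
by rewrite /has3 -!(perm_mem (knuth_perm h)).
Qed.

(** The value in the middle is not moved by the exchange, so the same case applies the second
    time. *)
Lemma dwordK k w : has3 k w -> dword k.+1 (dword k.+1 w) = w.
Proof.
move=> hw.
have hm a b : a \in w -> b \in w -> map (swp a b) w =i w.
  move=> aw bw x; rewrite -{1}[x](swpK a b) mem_map; last exact: can_inj (swpK a b).
  by rewrite /swp; case: eqP => [->|_]; rewrite ?aw ?bw //; case: eqP => [->|]; rewrite ?aw.
have mK a b : map (swp a b) (map (swp a b) w) = w.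
  by rewrite -map_comp -[RHS]map_id; apply: eq_map => x /=; apply: swpK.
case/and3P: (hw) => h0 h1 h2.
case: (dwordP hw) => b.
- by case: (dwordP hw) => // b'; move: b b'; rewrite /between; lia.
- case: dwordP; first by rewrite /has3 !hm ?h0 ?h1 ?h2.
  + rewrite !index_swp swp_l swp_r swp_id; try lia.
    by move: b; rewrite /between; lia.
  + by rewrite mK.
  rewrite !index_swp swp_l swp_r swp_id; try lia.
  by move: b; rewrite /between; lia.
case: dwordP; first by rewrite /has3 !hm ?h0 ?h1 ?h2.
- rewrite !index_swp swp_l swp_r swp_id; try lia.
  by move: b; rewrite /between; lia.
- rewrite !index_swp swp_l swp_r swp_id; try lia.
  by move: b; rewrite /between; lia.
by rewrite mK.
Qed.

Lemma dword_neq k w : has3 k w ->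
  (dword k.+1 w != w) =
  ((index k w < index k.+1 w) != (index k.+1 w < index k.+2 w)).
Proof.
move=> hw; have [h0 h1 h2] := and3P hw.
have neq a b : a != b -> a \in w -> map (swp a b) w != w.
  move=> ab aw; apply/eqP; rewrite -{2}[w]map_id => /eq_in_map/(_ a aw).
  by rewrite swp_l => /eqP; rewrite eq_sym (negPf ab).
case: (dwordP hw) => b.
- by rewrite eqxx; move: b; rewrite /between; lia.
- by rewrite neq //; first (move: b; rewrite /between); lia.
by rewrite neq //; first (move: b; rewrite /between); lia.
Qed.

(** * The maps d_i on standard tableaux *)

(** A cell of shape [la] is a pair with [j < nth 0 la r]; the default 0 makes this fail in missing
    rows, so that no bound on [r] has to be carried along. *)
Definition ent (T : tableau) (r j : nat) : nat := nth 0 (nth [::] T r) j.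

(* The position of the cell (r, j) in the row reading order. *)
Definition rpos (la : seq nat) (r j : nat) : nat := sumn (drop r.+1 la) + j.

Lemma nth_shape (T : tableau) r : nth 0 (shape T) r = size (nth [::] T r) :> nat.
Proof.
have [rT|Tr] := ltnP r (size T); first by rewrite (nth_map [::]).
by rewrite !nth_default // size_map.
Qed.

Lemma nth_rword T r j : j < nth 0 (shape T) r ->
  rpos (shape T) r j < size (rword T) /\
  nth 0 (rword T) (rpos (shape T) r j) = ent T r j.
Proof.
have szr T' : size (rword T') = sumn (shape T').
  by rewrite -size_flatten (perm_size (perm_rword T')).
elim: T r => [|s T IH] [|r] //= jr; rewrite rword_cons size_cat nth_cat.
  by rewrite /rpos /= drop0 szr ltn_add2l [_ + j < _]ltnNge leq_addr addKn.
by have [h1 h2] := IH r jr; rewrite ltn_addr // h1.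
Qed.

Lemma mem_rword T x : x \in rword T ->
  exists r j, j < nth 0 (shape T) r /\ x = ent T r j.
Proof.
elim: T => [|s T IH] //; rewrite rword_cons mem_cat => /orP[/IH[r [j [? ->]]]|xs].
  by exists r.+1, j.
by exists 0, (index x s); rewrite index_mem /ent /= nth_index.
Qed.

Lemma index_rword T r j : uniq (rword T) -> j < nth 0 (shape T) r ->
  index (ent T r j) (rword T) = rpos (shape T) r j.
Proof. by move=> uT /nth_rword[h <-]; rewrite index_uniq. Qed.

Lemma ent_mem T r j : j < nth 0 (shape T) r -> ent T r j \in rword T.
Proof. by move=> /nth_rword[h <-]; rewrite mem_nth. Qed.

Lemma sumn_drop (la : seq nat) r : sumn (drop r la) = nth 0 la r + sumn (drop r.+1 la).
Proof.
have [h|h] := ltnP r (size la); first by rewrite (drop_nth 0).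
by rewrite !drop_oversize ?nth_default // ltnW.
Qed.

Lemma sumn_drop_le (la : seq nat) r r' :
  r <= r' -> sumn (drop r' la) <= sumn (drop r la).
Proof.
elim: r' => [|r' IH]; rewrite leq_eqVlt => /predU1P[-> //|] //.
by move/IH/(leq_trans _); apply; rewrite [leqRHS]sumn_drop leq_addl.
Qed.

Lemma rpos_lt la r j r' j' : j < nth 0 la r -> j' < nth 0 la r' ->
  (rpos la r j < rpos la r' j') = (r' < r) || (r == r') && (j < j').
Proof.
rewrite /rpos => h h'; have [lt|lt|<-] := ltngtP r' r.
- by have := @sumn_drop_le la _ _ lt; have := sumn_drop la r; lia.
- by have := @sumn_drop_le la _ _ lt; have := sumn_drop la r'; lia.
by rewrite ltn_add2l.
Qed.

Lemma rows_sortedP (e : rel nat) T :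
  reflect (forall r j, j.+1 < nth 0 (shape T) r -> e (ent T r j) (ent T r j.+1))
          (all (sorted e) T).
Proof.
apply: (iffP (all_nthP [::])) => h r.
  move=> j; rewrite nth_shape => jr; have rT : r < size T.
    by case: (ltnP r (size T)) jr => // rT; rewrite nth_default.
  by have /sortedP := h r rT; apply.
by move=> rT; apply/(sortedP 0) => j jr; apply: h; rewrite nth_shape.
Qed.

Lemma cols_strictP T : sorted geq (shape T) ->
  reflect (forall r j, j < nth 0 (shape T) r.+1 -> ent T r j < ent T r.+1 j)
          (sorted col_strict T).
Proof.
move=> sT; apply: (iffP (sortedP [::])) => h r.
  move=> j; rewrite nth_shape => jr; have rT : r.+1 < size T.
    by case: (ltnP r.+1 (size T)) jr => // rT; rewrite nth_default.
  by have /col_strictP[_] := h r rT; apply.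
move=> rT; apply/col_strictP; split.
  by rewrite -!nth_shape; move/(sortedP 0): sT; apply; rewrite size_map.
by move=> j jr; apply: h; rewrite nth_shape.
Qed.

Lemma sytP n (la : intpart n) T :
  reflect [/\ shape T = la, perm_eq (rword T) (iota 1 n),
    forall r j, j.+1 < nth 0 la r -> ent T r j < ent T r j.+1 &
    forall r j, j < nth 0 la r.+1 -> ent T r j < ent T r.+1 j] (T \in SYT la).
Proof.
rewrite in_SYT (permPl (perm_rword T)); apply: (iffP and4P).
  case=> /eqP shT pT /rows_sortedP rT cT; split=> //; first by rewrite -shT.
  by rewrite -shT; apply/cols_strictP => //; rewrite shT; case/and3P: (intpartP la).
case=> shT pT rT cT; split=> //; first by rewrite shT.
  by apply/rows_sortedP; rewrite shT.
by apply/cols_strictP; rewrite shT //; case/and3P: (intpartP la).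
Qed.

Section SYTFacts.
Variables (n : nat) (la : intpart n) (T : tableau).
Hypothesis TS : T \in SYT la.

Lemma syt_shape : shape T = la. Proof. by case/sytP: TS. Qed.

Lemma syt_perm : perm_eq (rword T) (iota 1 n). Proof. by case/sytP: TS. Qed.

Lemma syt_uniq : uniq (rword T).
Proof. by rewrite (perm_uniq syt_perm) iota_uniq. Qed.

Lemma syt_mem x : (x \in rword T) = (0 < x <= n).
Proof. by rewrite (perm_mem syt_perm) mem_iota add1n ltnS. Qed.

Lemma syt_row r j j' : j < j' -> j' < nth 0 la r -> ent T r j < ent T r j'.
Proof.
case/sytP: TS => _ _ h _ lt; elim: j' lt => // j' IH; rewrite ltnS leq_eqVlt.
by case/predU1P=> [->|/IH h'] h2; [apply: h|apply: ltn_trans (h _ _ h2); apply: h' (ltnW h2)].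
Qed.

Lemma syt_col r j : j < nth 0 la r.+1 -> ent T r j < ent T r.+1 j.
Proof. by case/sytP: TS => _ _ _; apply. Qed.

Lemma syt_cell_below r j : j < nth 0 la r.+1 -> j < nth 0 la r.
Proof.
case/and3P: (intpartP la) => /(sortedP 0) s _ _ h.
have [lt|ge] := ltnP r.+1 (size la); first by apply: leq_trans h (s _ lt).
by rewrite nth_default in h.
Qed.

Lemma syt_index r j : j < nth 0 la r -> index (ent T r j) (rword T) = rpos la r j.
Proof. by move=> h; rewrite index_rword ?syt_shape ?syt_uniq. Qed.

Lemma syt_cell x : x \in rword T -> exists r j, j < nth 0 la r /\ x = ent T r j.
Proof. by move/mem_rword; rewrite syt_shape. Qed.

Lemma syt_inj r j r' j' : j < nth 0 la r -> j' < nth 0 la r' ->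
  ent T r j = ent T r' j' -> r = r' /\ j = j'.
Proof.
move=> h h' e; have := syt_index h; rewrite e syt_index // => er.
have := rpos_lt h h'; have := rpos_lt h' h; rewrite er ltnn; lia.
Qed.

Lemma ent_map (f : nat -> nat) (r j : nat) : j < nth 0 la r ->
  ent (map (map f) T) r j = f (ent T r j).
Proof.
rewrite -syt_shape nth_shape /ent => jr; have rT : r < size T.
  by case: (ltnP r (size T)) jr => // rT; rewrite nth_default.
by rewrite (nth_map [::]) // (nth_map 0).
Qed.

(* Exchanging a and a+1 can only break standardness if their cells are adjacent;
   then they are consecutive in the reading word, or a+1 sits right above a and
   the letter read between them has no room next to these two cells. *)
Lemma syt_swp a c : 0 < a < n -> 0 < c <= n -> c.+1 = a \/ c = a.+2 ->
  between (index a (rword T)) (index c (rword T)) (index a.+1 (rword T)) ->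
  map (map (swp a a.+1)) T \in SYT la.
Proof.
move=> an cn ca bt.
have [r0 [j0 [h0 e0]]] : exists r j, j < nth 0 la r /\ a = ent T r j.
  by apply: syt_cell; rewrite syt_mem; lia.
have [r1 [j1 [h1 e1]]] : exists r j, j < nth 0 la r /\ a.+1 = ent T r j.
  by apply: syt_cell; rewrite syt_mem; lia.
have [r2 [j2 [h2 e2]]] : exists r j, j < nth 0 la r /\ c = ent T r j.
  by apply: syt_cell; rewrite syt_mem.
move: bt; rewrite [in index a.+1 _]e1 [in index a _]e0 [in index c _]e2 !syt_index //.
rewrite /between !rpos_lt // => bt.
have shm : shape (map (map (swp a a.+1)) T) = la.
  by rewrite -syt_shape /shape -map_comp; apply: eq_map => s /=; rewrite size_map.
apply/sytP; split=> // [|r j h|r j h].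
- rewrite /rword -map_rev -map_flatten -/(rword T).
  apply: uniq_perm; rewrite ?iota_uniq //.
    by rewrite map_inj_uniq ?syt_uniq //; apply: can_inj (swpK _ _).
  move=> x; rewrite -{1}[x](swpK a a.+1) mem_map; last exact: can_inj (swpK _ _).
  by rewrite syt_mem mem_iota /swp; do !case: eqP => //; lia.
- have hj := ltnW h; rewrite !ent_map //; apply: swp_lt; first exact: syt_row.
  case=> ea eb.
  have [? ?] := syt_inj h0 hj (etrans (esym e0) (esym ea)).
  have [? ?] := syt_inj h1 h (etrans (esym e1) (esym eb)).
  lia.
have hj := syt_cell_below h.
rewrite !ent_map //; apply: swp_lt; first exact: syt_col.
case=> ea eb.
have [? ?] := syt_inj h0 hj (etrans (esym e0) (esym ea)).
have [? ?] := syt_inj h1 h (etrans (esym e1) (esym eb)).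
subst r0 j0 r1 j1.
have lec r' i i' : i <= i' -> i' < nth 0 la r' -> ent T r' i <= ent T r' i'.
  by rewrite leq_eqVlt => /predU1P[->|lt i'r] //; apply/ltnW/syt_row.
have [[? lt]|[? lt]] : (r2 = r.+1 /\ j < j2) \/ (r2 = r /\ j2 < j) by lia.
  (* Here [c = a.+2], and the cell [(r, j.+1)] would hold a value strictly between [a] and [a.+2], a
     second [a.+1]. *)
  subst r2; have b1 := syt_row lt h2.
  have h3 := leq_ltn_trans lt h2; have b2 := lec _ _ _ lt h2.
  have h4 := syt_cell_below h3; have b3 := syt_col h3; have b4 := syt_row (ltnSn j) h4.
  by have [] := @syt_inj r j.+1 r.+1 j h4 h; lia.
(* Here [c.+1 = a], and the cell above the left neighbour of [a] would hold a value strictly between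
   [a.-1] and [a.+1], a second [a]. *)
subst r2; have b1 := syt_row lt hj.
case: j {bt} ea eb h hj e0 h0 e1 h1 lt b1 => // j ea eb h hj e0 h0 e1 h1 lt b1.
have b2 := lec r j2 j lt (ltnW hj); have h3 := ltnW h.
have b3 := syt_col h3; have b4 := syt_row (ltnSn j) h.
by have [] := @syt_inj r.+1 j r j.+1 h3 hj; lia.
Qed.

End SYTFacts.

Lemma syt_has3 n (la : intpart n) T k : T \in SYT la -> 0 < k -> k.+2 <= n ->
  has3 k (rword T).
Proof. by move=> TS k0 kn; rewrite /has3 !(syt_mem TS); lia. Qed.

Lemma dtab_map T (f : nat -> nat) :
  rev (reshape (rev (shape T)) (map f (rword T))) = map (map f) T.
Proof.
rewrite /rword map_flatten /shape -map_rev.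
have -> : map size (rev T) = shape (map (map f) (rev T)).
  by rewrite /shape -map_comp; apply: eq_map => s /=; rewrite size_map.
by rewrite flattenK -map_rev revK.
Qed.

Lemma map_id_tab (T : tableau) : map (map id) T = T.
Proof. by rewrite -[RHS]map_id; apply: eq_map => s; apply: map_id. Qed.

Lemma rword_map T (f : nat -> nat) : rword (map (map f) T) = map f (rword T).
Proof. by rewrite /rword -map_rev map_flatten. Qed.

Lemma dtab_syt n (la : intpart n) T i : T \in SYT la -> 1 < i < n ->
  dtab i T \in SYT la /\ rword (dtab i T) = dword i (rword T).
Proof.
case: i => // k TS /andP[k0 kn]; have hT := syt_has3 TS k0 kn.
rewrite /dtab; case: (dwordP hT) => bt.
- suff -> : rev (reshape (rev (shape T)) (rword T)) = T by [].
  by rewrite -[rword T]map_id dtab_map map_id_tab.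
- rewrite dtab_map rword_map; split=> //.
  by apply: (syt_swp TS (c := k)) => //; lia.
rewrite dtab_map rword_map; split=> //.
by apply: (syt_swp TS (c := k.+2)) => //; lia.
Qed.

Lemma Ptab_dword n w i : perm_eq w (iota 1 n) -> 1 < i < n ->
  Ptab (dword i w) = dtab i (Ptab w).
Proof.
move=> pw ni; have [la PS] := Ptab_syt pw.
have [dS dw] := dtab_syt PS ni.
rewrite -(Ptab_rword_syt dS) dw; apply: Ptab_knuth.
case: i ni {dS dw} => // k /andP[k0 kn]; apply: dword_knuth (knuth_Ptab w).
  by rewrite (perm_uniq pw) iota_uniq.
by rewrite /has3 !(perm_mem pw) !mem_iota; lia.
Qed.

Lemma dtabK n (la : intpart n) T i : T \in SYT la -> 1 < i < n ->
  dtab i (dtab i T) = T.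
Proof.
move=> TS ni; have [dS dw] := dtab_syt TS ni; have [ddS ddw] := dtab_syt dS ni.
rewrite -(Ptab_rword_syt ddS) ddw dw -[RHS](Ptab_rword_syt TS).
by case: i ni {dS dw ddS ddw} => // k /andP[k0 kn]; rewrite dwordK // (syt_has3 TS).
Qed.

Lemma signature_Ptab n w : perm_eq w (iota 1 n) ->
  signature n (rword (Ptab w)) = signature n w.
Proof.
move=> pw; apply/esym/knuth_signature; last exact: knuth_Ptab.
by rewrite (perm_uniq pw) iota_uniq.
Qed.

Lemma signature_sgn n w i : 0 < i < n ->
  sgn (signature n w) i = (index i w < index i.+1 w).
Proof.
case: i => // i /= ni; have lt : i < n.-1 by lia.
by rewrite /sgn -(tnth_nth false _ (Ordinal lt)) tnth_mktuple.
Qed.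

Lemma dtab_neq n (la : intpart n) T i : T \in SYT la -> 1 < i < n ->
  (dtab i T != T) = admits (signature n (rword T)) i.
Proof.
case: i => // k TS ni; have hT : has3 k (rword T) by apply: syt_has3 TS _ _; lia.
rewrite /admits !signature_sgn /=; try lia; rewrite -dword_neq //.
have [dS dw] := dtab_syt TS ni; rewrite -dw; congr (~~ _); apply/eqP/eqP => [-> //|e].
by rewrite -(Ptab_rword_syt dS) e (Ptab_rword_syt TS).
Qed.

(** * Insertion of growing Young diagrams *)

(** A standard tableau seen as a chain of Young diagrams: the neighbours of a new cell below and to
    the left are already present. *)
Inductive grow : seq (nat * nat) -> Prop :=
| Grow_nil : grow [::]
| Grow_rcons C r j of grow C & (r, j) \notin C &
    (r == 0) || ((r.-1, j) \in C) & (j == 0) || ((r, j.-1) \in C) :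
    grow (rcons C (r, j)).

Definition colh (C : seq (nat * nat)) (j : nat) := count (fun c => c.2 == j) C.

Definition roww (C : seq (nat * nat)) := count (fun c => c.1 == 0) C.

(** The diagram without its bottom row, moved down. A cell outside the bottom row bumps the label of
    the cell just below it, which is the label of its own image here. *)
Definition shift (C : seq (nat * nat)) := [seq (c.1.-1, c.2) | c <- C & 0 < c.1].

Lemma colh_rcons C r j j' : colh (rcons C (r, j)) j' = colh C j' + (j == j').
Proof. by rewrite /colh -cats1 count_cat /= addn0. Qed.

Lemma roww_rcons C r j : roww (rcons C (r, j)) = roww C + (r == 0).
Proof. by rewrite /roww -cats1 count_cat /= addn0. Qed.

Lemma mem_grow_col C r j : grow C -> ((r, j) \in C) = (r < colh C j).
Proof.
move=> gC; elim: gC r j => {C} // C r0 j0 gC IH ni up _ r j.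
rewrite mem_rcons inE colh_rcons xpair_eqE IH; rewrite !IH in ni up.
by have [->|ne] := eqVneq j j0; rewrite ?eqxx ?(eq_sym j0) ?(negPf ne) /=; lia.
Qed.

Lemma mem_grow_row C j : grow C -> ((0, j) \in C) = (j < roww C).
Proof.
move=> gC; elim: gC j => {C} // C r0 j0 gC IH ni _ left j.
rewrite mem_rcons inE roww_rcons xpair_eqE IH.
have [r00|r0n] := eqVneq r0 0; last by rewrite addn0.
by move: left ni; rewrite r00 !IH; lia.
Qed.

Lemma grow_left C r j j' : grow C -> (r, j) \in C -> j' <= j -> (r, j') \in C.
Proof.
move=> gC; elim: gC r j j' => {C} // C r0 j0 gC IH _ _ left r j j'.
rewrite !mem_rcons !inE => /predU1P[[-> ->]|h jj]; last by rewrite (IH _ _ _ h jj) orbT.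
rewrite leq_eqVlt => /predU1P[->|lt]; first by rewrite eqxx.
case/orP: left => [/eqP j00|h]; first by rewrite j00 in lt.
by rewrite (IH _ _ _ h) ?orbT //; lia.
Qed.

Lemma mem_shift C r j : ((r, j) \in shift C) = ((r.+1, j) \in C).
Proof.
apply/mapP/idP => [[[r' j']]|h]; last by exists (r.+1, j); rewrite ?mem_filter.
by rewrite mem_filter /= => /andP[r0 h] [-> ->]; rewrite prednK.
Qed.

Lemma shift_rcons C r j :
  shift (rcons C (r, j)) = if r is r'.+1 then rcons (shift C) (r', j) else shift C.
Proof. by rewrite /shift filter_rcons; case: r => //= r; rewrite map_rcons. Qed.

Lemma grow_shift C : grow C -> grow (shift C).
Proof.
elim=> {C} [|C r j gC IH ni up left]; first exact: Grow_nil.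
rewrite shift_rcons; case: r ni up left => // r ni up left.
apply: Grow_rcons => //; rewrite mem_shift //.
by case: r {ni left} up => //= r; rewrite mem_shift.
Qed.

(* Labels increase in the row reading order of the cells (row, column). *)
Definition order_label (L : nat * nat -> nat) (C : seq (nat * nat)) :=
  {in C &, forall c c', (c'.1 < c.1) || (c.1 == c'.1) && (c.2 < c'.2) -> L c < L c'}.

Definition tops (L : nat * nat -> nat) (C : seq (nat * nat)) :=
  [seq L ((colh C j).-1, j) | j <- iota 0 (roww C)].

(* The row consists of the topmost cells of the columns: a new cell outside the
   bottom row bumps the cell right below it. *)
Lemma rowins_tops L C r j : grow (rcons C (r, j)) -> order_label L (rcons C (r, j)) ->
  rowins (tops L C) (L (r, j)) =
  (tops L (rcons C (r, j)), if r is r'.+1 then [:: L (r', j)] else [::]).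
Proof.
move=> g oL; have [gC ni up left] : [/\ grow C, (r, j) \notin C,
    (r == 0) || ((r.-1, j) \in C) & (j == 0) || ((r, j.-1) \in C)].
  move E: (rcons C (r, j)) g => D g; case: g E => [|C' r' j' ? ? ? ?].
    by move/(congr1 size); rewrite size_rcons.
  by move/rcons_inj => -[-> -> ->].
have mr c : c \in C -> c \in rcons C (r, j) by rewrite mem_rcons inE orbC => ->.
have mL : (r, j) \in rcons C (r, j) by rewrite mem_rcons inE eqxx.
(* A column to the left of [j] ends in row [r] or higher, so its top comes before the new cell in
   the reading order. *)
have small j' : j' < j -> (0 < r -> (r, j') \in C) -> j' < roww C ->
    L ((colh C j').-1, j') <= L (r, j).
  move=> jj hr jw; apply/ltnW/oL => //.
    apply/mr; rewrite mem_grow_col // prednK //.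
    by rewrite -mem_grow_col // mem_grow_row.
  have [r0|/hr] := posnP r; first by rewrite /= r0 jj; lia.
  by rewrite mem_grow_col //=; lia.
case: r => [|r] in g oL ni up left mr mL small *.
  have ej : j = roww C by move: ni left; rewrite !mem_grow_row //; lia.
  have al : all (geq (L (0, j))) (tops L C).
    apply/allP => x /mapP[j']; rewrite mem_iota add0n => /andP[_ jw] ->.
    by apply: small => //; rewrite ej.
  have := rowins_catl [::] al; rewrite cats0 => -> /=; congr pair.
  rewrite /tops roww_rcons eqxx addn1 -[in RHS]addn1 iotaD map_cat /= add0n; congr (_ ++ _).
    apply/eq_in_map => j'; rewrite mem_iota add0n => /andP[_ jw]; rewrite colh_rcons.
    by case: eqP => [e|_]; [lia|rewrite addn0].
  rewrite -ej colh_rcons eqxx; move: ni; rewrite mem_grow_col // -leqNgt leqn0.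
  by move/eqP->.
have hj : colh C j = r.+1 by move: ni up; rewrite !mem_grow_col //=; lia.
have jw : j < roww C by rewrite -mem_grow_row // mem_grow_col // hj.
(* The row is cut at column [j]: its top [(r, j)] comes after the new cell in the reading order,
   while the labels to the left are at most the new one, so this top is bumped. *)
rewrite /tops roww_rcons addn0 -(subnKC jw) addSnnS iotaD /= !map_cat /= add0n.
rewrite rowins_catl.
  rewrite /= hj /= colh_rcons eqxx hj addn1 /=.
  have -> : L (r.+1, j) < L (r, j) by apply: oL => //=; [apply/mr; rewrite mem_grow_col ?hj|lia].
  congr (_ ++ _ :: _, _); apply/eq_in_map => j'; rewrite mem_iota colh_rcons => h;
    by case: eqP => [e|_]; [lia|rewrite addn0].
apply/allP => x /mapP[j']; rewrite mem_iota add0n => /andP[_ jj] ->.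
apply: small => //; last exact: ltn_trans jj jw.
move=> _; case/orP: left => [/eqP j0|h]; first by rewrite j0 in jj.
by apply: grow_left gC h _; lia.
Qed.

Lemma rowinsw_grow L C : grow C -> order_label L C ->
  rowinsw [::] (map L C) = (tops L C, map L (shift C)).
Proof.
move=> g; elim: (g) => {C g} // C r j g IH ni up left oL.
have gr : grow (rcons C (r, j)) by apply: Grow_rcons.
rewrite map_rcons -cats1 rowinsw_cat IH; last first.
  by move=> c c' hc hc'; apply: oL; rewrite mem_rcons inE ?hc ?hc' orbT.
rewrite /= rowins_tops // cats0 shift_rcons; congr pair.
by case: r {ni up left oL gr} => [|r]; rewrite ?cats0 // map_rcons cats1.
Qed.

(** The bottom row of the tableau is read off the column heights, hence from the set of cells; the
    other rows come from the labels of the shifted diagrams, which have one row less. *)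
Lemma Ptab_grow L C C' : grow C -> grow C' -> perm_eq C C' -> order_label L C ->
  Ptab (map L C) = Ptab (map L C').
Proof.
have [m] : exists m, all (fun c => c.1 < m) C.
  exists (\max_(c <- C) c.1).+1; apply/allP => c cC.
  by rewrite ltnS; apply: (@leq_bigmax_seq _ _ xpredT (fun c : nat * nat => c.1)).
elim: m C C' => [|m IH] C C' bC gC gC' pC oL.
  case: C bC pC {gC oL} => // _; rewrite perm_sym => /perm_nilP -> //.
have oL' : order_label L C' by move=> c c'; rewrite -!(perm_mem pC); apply: oL.
have Pg D : grow D -> order_label L D -> D <> [::] ->
    Ptab (map L D) = tops L D :: Ptab (map L (shift D)).
  move=> gD oD; case: D gD oD => // c D gD oD _.
  by rewrite /= foldl_insert_nil foldl_insert_cons -/(map L (c :: D)) rowinsw_grow.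
have [C0|/eqP C0] := eqVneq C [::].
  by move: pC; rewrite C0 perm_sym => /perm_nilP ->.
have C0' : C' <> [::] by move=> e; apply: C0; move: pC; rewrite e => /perm_nilP.
rewrite (Pg C) // (Pg C') //; congr (_ :: _).
  rewrite /tops /roww (seq.permP pC); apply: eq_map => j; congr (L (_.-1, _)).
  exact: (seq.permP pC).
apply: IH; try exact: grow_shift.
- apply/allP => -[r j]; rewrite mem_shift => /(allP bC) /=; lia.
- exact/perm_map/perm_filter.
move=> [r j] [r' j']; rewrite !mem_shift !mem_grow_col // => h h'.
by apply: oL; rewrite mem_grow_col // ltnW.
Qed.

(** * Connectivity of SYT(la) *)

Definition cellof (T : tableau) (k : nat) : nat * nat :=
  let r := find (fun s : seq nat => k \in s) T in (r, index k (nth [::] T r)).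

Lemma cellofP T k : k \in rword T ->
  (cellof T k).2 < nth 0 (shape T) (cellof T k).1 /\
  ent T (cellof T k).1 (cellof T k).2 = k.
Proof.
move=> kT; have hk : has (fun s : seq nat => k \in s) T.
  move: kT; rewrite (perm_mem (perm_rword T)) => /flattenP[s sT ks].
  by apply/hasP; exists s.
have h := nth_find [::] hk; rewrite nth_shape /= /ent /=.
by rewrite index_mem nth_index.
Qed.

(** The inverse permutation in one-line notation, with letters 0, ..., n-1 because positions count
    from 0. *)
Definition invw (n : nat) (w : seq nat) : seq nat := [seq index k w | k <- iota 1 n].

Section CellWord.
Variables (n : nat) (la : intpart n) (T : tableau).
Hypothesis TS : T \in SYT la.

Lemma syt_cellof k : 0 < k <= n ->
  (cellof T k).2 < nth 0 la (cellof T k).1 /\ ent T (cellof T k).1 (cellof T k).2 = k.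
Proof. by rewrite -(syt_mem TS) => /cellofP; rewrite (syt_shape TS). Qed.

Lemma cellof_ent r j : j < nth 0 la r -> cellof T (ent T r j) = (r, j).
Proof.
move=> h; have /cellofP[] : ent T r j \in rword T.
  by apply: ent_mem; rewrite (syt_shape TS).
rewrite (syt_shape TS) => h' e; have [er ej] := syt_inj TS h' h e.
by rewrite [LHS]surjective_pairing er ej.
Qed.

Lemma mem_cells m r j : j < nth 0 la r -> m <= n ->
  ((r, j) \in map (cellof T) (iota 1 m)) = (ent T r j <= m).
Proof.
move=> h mn; apply/mapP/idP => [[k]|le].
  rewrite mem_iota add1n ltnS => /andP[k0 km] e.
  have [_] := @syt_cellof k ltac:(lia); by rewrite -e /= => ->.
exists (ent T r j); last by rewrite cellof_ent.
have : ent T r j \in rword T by apply: ent_mem; rewrite (syt_shape TS).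
by rewrite (syt_mem TS) mem_iota add1n ltnS => /andP[->].
Qed.

(** The neighbours of a cell below and to the left hold smaller entries, so the cells with entries
    at most [m] form a Young diagram. *)
Lemma grow_cells : grow (map (cellof T) (iota 1 n)).
Proof.
suff h m : m <= n -> grow (map (cellof T) (iota 1 m)) by exact: h.
elim: m => [|m IH] mn; first exact: Grow_nil.
have -> : iota 1 m.+1 = rcons (iota 1 m) m.+1.
  by rewrite -[in LHS](addn1 m) iotaD add1n cats1.
rewrite map_rcons.
have [] := @syt_cellof m.+1 mn; case: (cellof T m.+1) => r j /= h e.
apply: Grow_rcons; first exact/IH/ltnW.
- by rewrite mem_cells ?e ?ltnn // ltnW.
- case: r h e => //= r h e; rewrite mem_cells; try exact: ltnW.
    by rewrite -ltnS -e (syt_col TS).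
  exact: syt_cell_below h.
case: j h e => //= j h e; rewrite mem_cells; try exact: ltnW.
by rewrite -ltnS -e (syt_row TS).
Qed.

Lemma cells_mem r j : ((r, j) \in map (cellof T) (iota 1 n)) = (j < nth 0 la r).
Proof.
have [h|h] := ltnP j (nth 0 la r).
  rewrite mem_cells //; have : ent T r j \in rword T.
    by apply: ent_mem; rewrite (syt_shape TS).
  by rewrite (syt_mem TS) => /andP[].
apply/negP => /mapP[k]; rewrite mem_iota add1n ltnS => /syt_cellof[+ _] e.
by rewrite -e ltnNge h.
Qed.

Lemma cells_uniq : uniq (map (cellof T) (iota 1 n)).
Proof.
rewrite map_inj_in_uniq ?iota_uniq // => k k'; rewrite !mem_iota add1n !ltnS.
by move=> /syt_cellof[_ {2}<-] /syt_cellof[_ {2}<-] ->.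
Qed.

Lemma invw_cells : invw n (rword T) =
  map (fun c => rpos la c.1 c.2) (map (cellof T) (iota 1 n)).
Proof.
rewrite -map_comp; apply/eq_in_map => k; rewrite mem_iota add1n ltnS => h.
have [h1 {1}<-] := syt_cellof h; exact: syt_index.
Qed.

End CellWord.

Lemma Ptab_invw n (la : intpart n) T T' : T \in SYT la -> T' \in SYT la ->
  Ptab (invw n (rword T)) = Ptab (invw n (rword T')).
Proof.
move=> TS TS'; rewrite (invw_cells TS) (invw_cells TS').
apply: Ptab_grow; [exact: grow_cells TS|exact: grow_cells TS'|..].
  apply: uniq_perm; rewrite ?(cells_uniq TS) ?(cells_uniq TS') // => -[r j].
  by rewrite (cells_mem TS) (cells_mem TS').
move=> [r j] [r' j']; rewrite !(cells_mem TS) => h h' /= o.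
by rewrite rpos_lt.
Qed.

Lemma invw_inj n u v : perm_eq u (iota 1 n) -> perm_eq v (iota 1 n) ->
  invw n u = invw n v -> u = v.
Proof.
move=> pu pv /eq_in_map e; have uu : uniq u by rewrite (perm_uniq pu) iota_uniq.
have sz : size u = size v by rewrite (perm_size pu) (perm_size pv).
apply: (@eq_from_nth _ 0) => // i iu.
have xu := mem_nth 0 iu; have := e (nth 0 u i).
rewrite -(perm_mem pu) xu index_uniq // => /(_ isT) ei.
by rewrite [in RHS]ei nth_index // (perm_mem pv) -(perm_mem pu).
Qed.

Lemma invw_uniq n w : perm_eq w (iota 1 n) -> uniq (invw n w).
Proof.
move=> pw; rewrite map_inj_in_uniq ?iota_uniq // => x y; rewrite -!(perm_mem pw).
by move=> xw yw e; rewrite -(nth_index 0 xw) e nth_index.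
Qed.

Lemma nth_invw n w k : k < n -> nth 0 (invw n w) k = index k.+1 w.
Proof. by move=> kn; rewrite (nth_map 0) ?size_iota // nth_iota // add1n. Qed.

(** Positions in the inverse are values in [w], shifted by one since values start at 1. *)
Lemma invw_swp n w C p q D : invw n w = C ++ [:: p; q] ++ D ->
  invw n (map (swp (size C).+1 (size C).+2) w) = C ++ [:: q; p] ++ D.
Proof.
move=> e; have sz : n = size C + (size D).+2.
  by have := congr1 size e; rewrite size_map size_iota size_cat.
apply: (@eq_from_nth _ 0).
  by rewrite size_map size_iota size_cat.
move=> i; rewrite size_map size_iota => lt; rewrite nth_invw // index_swp.
have nw k : k < n -> index k.+1 w = nth 0 (C ++ [:: p; q] ++ D) k.
  by move=> kn; rewrite -e nth_invw.
have nC s k : nth 0 (C ++ s) (size C + k) = nth 0 s k.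
  by rewrite nth_cat ltnNge leq_addr addKn.
have nC0 s := nC s 0; have nC1 s := nC s 1; rewrite addn0 in nC0; rewrite addn1 in nC1.
have [->|n1] := eqVneq i (size C); first by rewrite swp_l nw ?nC1 ?nC0 //; lia.
have [->|n2] := eqVneq i (size C).+1; first by rewrite swp_r nw ?nC1 ?nC0 //; lia.
rewrite swp_id // nw //; have [lti|gei] := ltnP i (size C); first by rewrite !nth_cat lti.
by have [k ->] : exists k, i = size C + k.+2; [exists (i - size C).-2; lia|rewrite !nC].
Qed.

Definition knuth1_sym u v := sknuth1 u v \/ sknuth1 v u.

(* A Knuth move on the inverse permutation exchanges the positions of two
   consecutive values, the position of a third one being in between. *)
Lemma knuth1_invw n w v : perm_eq w (iota 1 n) -> knuth1_sym (invw n w) v ->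
  exists2 i, 1 < i < n & v = invw n (dword i w).
Proof.
(* The letters [a], [b], [c] are the positions in [w] of [i.-1], [i], [i.+1] for
   [i = (size A).+2]. *)
move=> pw; have main A B a b c : invw n w = A ++ [:: a; b; c] ++ B ->
    [/\ 1 < (size A).+2 < n, between b a c ->
      A ++ [:: a; c; b] ++ B = invw n (dword (size A).+2 w) &
      between a c b -> A ++ [:: b; a; c] ++ B = invw n (dword (size A).+2 w)].
  move=> e; have sz : n = size A + (size B).+3.
    by have := congr1 size e; rewrite size_map size_iota size_cat.
  have nA k : k < 3 -> index (size A + k).+1 w = nth 0 [:: a; b; c] k.
    move=> k3; rewrite -(@nth_invw n); last lia.
    by rewrite e nth_cat ltnNge leq_addr addKn; case: k k3 => [|[|[|]]].
  have h3 : has3 (size A).+1 w.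
    by rewrite /has3 !(perm_mem pw) !mem_iota; lia.
  have := (nA 0, nA 1, nA 2); rewrite addn0 addn1 addn2 /= => -[[i0 i1] i2].
  have {}i0 := i0 isT; have {}i1 := i1 isT; have {}i2 := i2 isT.
  split; first lia.
    move=> bt; case: (dwordP h3); rewrite i0 i1 i2;
      try by move: bt; rewrite /between; lia.
    move=> _; have := @invw_swp n w (A ++ [:: a]) b c B.
    by rewrite -!catA size_cat addn1 /= => ->.
  move=> bt; case: (dwordP h3); rewrite i0 i1 i2;
    try by move: bt; rewrite /between; lia.
  by move=> _; have := @invw_swp n w A a b (c :: B) e => ->.
have fin m (P Q : Prop) u : [/\ 1 < m < n, P -> u = invw n (dword m w) & Q] -> P ->
    exists2 i, 1 < i < n & u = invw n (dword i w).
  by case=> h h' _ /h' e; exists m.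
have fin' m (P Q : Prop) u : [/\ 1 < m < n, Q & P -> u = invw n (dword m w)] -> P ->
    exists2 i, 1 < i < n & u = invw n (dword i w).
  by case=> h _ h' /h' e; exists m.
case; move E : (invw n w) => u k; case: k E => A B x y z h /main.
- by move/fin; apply; rewrite /between; lia.
- by move/fin'; apply; rewrite /between; lia.
- by move/fin; apply; rewrite /between; lia.
by move/fin'; apply; rewrite /between; lia.
Qed.

(** Connectivity is phrased by invariants: a function constant along every d_i is constant. It is
    applied to the size of the fibers. *)
Lemma dual_connected n (la : intpart n) (S : Type) (f : tableau -> S) :
  (forall T i, T \in SYT la -> 1 < i < n -> f (dtab i T) = f T) ->
  {in SYT la &, forall T T', f T = f T'}.
Proof.
move=> fd T T' TS TS'.
(* A word in the middle of a Knuth chain is not known beforehand to be the inverse of a reading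
   word; [Q] carries a tableau of shape [la] along the chain. *)
pose Q u v := forall T, T \in SYT la -> u = invw n (rword T) ->
  exists T', [/\ T' \in SYT la, f T' = f T & v = invw n (rword T')].
have step u v : knuth1_sym u v -> Q u v.
  move=> k {T T' TS TS'} T TS e; rewrite e in k.
  have [i ni ->] := knuth1_invw (syt_perm TS) k.
  have [dS dw] := dtab_syt TS ni.
  by exists (dtab i T); rewrite dw fd.
have H u v : knuth u v -> uniq u -> Q u v /\ Q v u.
  elim=> {u v} [u v k|u|u v k IH|u v w k IH k' IH'] uu.
  - by have := knuth1_strict uu k; split; apply: step; [left|right].
  - by split=> T0 T0S ->; exists T0.
  - by have [] := IH (knuth_uniq uu (knuth_sym k)).
  have [h1 h2] := IH uu; have [h3 h4] := IH' (knuth_uniq uu k).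
  split=> T0 T0S e.
    have [T1 [T1S f1 e1]] := h1 _ T0S e; have [T2 [T2S f2 e2]] := h3 _ T1S e1.
    by exists T2; rewrite f2.
  have [T1 [T1S f1 e1]] := h4 _ T0S e; have [T2 [T2S f2 e2]] := h2 _ T1S e1.
  by exists T2; rewrite f2.
have kT : knuth (invw n (rword T)) (invw n (rword T')).
  apply: knuth_trans (knuth_Ptab _) _; rewrite (Ptab_invw TS TS').
  exact/knuth_sym/knuth_Ptab.
have [h _] := H _ _ kT (invw_uniq (syt_perm TS)).
have [T1 [T1S f1 e1]] := h _ TS erefl.
have e := invw_inj (syt_perm TS') (syt_perm T1S) e1.
by rewrite -f1 -(Ptab_rword_syt TS') e (Ptab_rword_syt T1S).
Qed.

(** * Standardization *)

Lemma standardization_exists (n : nat) (lt : rel nat) :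
  irreflexive lt -> transitive lt ->
  (forall p q, p < n -> q < n -> p <> q -> lt p q || lt q p) ->
  exists2 f, perm_eq f (iota 1 n) &
    forall p q, p < n -> q < n -> (nth 0 f p < nth 0 f q) = lt p q.
Proof.
move=> irr tr tot; pose c p := count (lt^~ p) (iota 0 n).
pose f := [seq (c p).+1 | p <- iota 0 n].
have szf : size f = n by rewrite size_map size_iota.
have nf p : p < n -> nth 0 f p = (c p).+1.
  by move=> pn; rewrite (nth_map 0) ?size_iota // nth_iota.
have upf p : uniq (p :: filter (lt^~ p) (iota 0 n)).
  by rewrite /= filter_uniq ?iota_uniq // mem_filter irr.
have cS p q : p < n -> lt p q -> c p < c q.
  move=> pn pq; rewrite /c -!size_filter.
  apply: (uniq_leq_size (upf p)) => x; rewrite inE !mem_filter => /predU1P[->|].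
    by rewrite pq mem_iota.
  by case/andP=> xp ->; rewrite (tr _ _ _ xp pq).
have fE p q : p < n -> q < n -> (nth 0 f p < nth 0 f q) = lt p q.
  move=> pn qn; rewrite !nf // ltnS; apply/idP/idP => [h|]; last exact: cS.
  have [e|/eqP ne] := eqVneq p q; first by rewrite e ltnn in h.
  case/orP: (tot _ _ pn qn ne) => // /(cS _ _ qn); lia.
exists f => //; have uf : uniq f.
  rewrite map_inj_in_uniq ?iota_uniq // => p q; rewrite !mem_iota !add0n /=.
  move=> pn qn [e]; have [//|/eqP ne] := eqVneq p q.
  by case/orP: (tot _ _ pn qn ne) => [/(cS _ _ pn)|/(cS _ _ qn)]; rewrite e ltnn.
have sf : {subset f <= iota 1 n}.
  move=> y /mapP[p]; rewrite mem_iota add0n => /andP[_ pn] ->.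
  rewrite mem_iota add1n /= ltnS /c -size_filter -[X in _ <= X](size_iota 0).
  apply: (uniq_leq_size (upf p)) => x; rewrite inE mem_filter => /predU1P[->|].
    by rewrite mem_iota.
  by case/andP.
apply: uniq_perm; rewrite ?iota_uniq //.
by case: (uniq_min_size uf sf) => //; rewrite size_iota szf.
Qed.

(** In a permutation a letter is one more than the number of smaller letters, so the order
    determines it. *)
Lemma standardization_unique n f f' :
  perm_eq f (iota 1 n) -> perm_eq f' (iota 1 n) ->
  (forall p q, p < n -> q < n ->
     (nth 0 f p < nth 0 f q) = (nth 0 f' p < nth 0 f' q)) -> f = f'.
Proof.
have key g p : perm_eq g (iota 1 n) -> p < n ->
    nth 0 g p = (count (fun q => nth 0 g q < nth 0 g p) (iota 0 n)).+1.
  move=> pg pn; have sz : size g = n by rewrite (perm_size pg) size_iota.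
  set x := nth 0 g p.
  have -> : count (fun q => nth 0 g q < x) (iota 0 n) = count (fun y => y < x) g.
    by rewrite -[in RHS](mkseq_nth 0 g) /mkseq sz count_map.
  rewrite (seq.permP pg).
  have : x \in iota 1 n by rewrite -(perm_mem pg) mem_nth ?sz.
  rewrite mem_iota => /andP[x0 xn]; have -> : n = x.-1 + (n - x.-1) by lia.
  rewrite iotaD count_cat (eq_in_count (a2 := predT)) => [|y]; last first.
    by rewrite mem_iota /=; lia.
  rewrite count_predT size_iota (eq_in_count (a2 := pred0)) => [|y].
    by rewrite count_pred0; lia.
  by rewrite mem_iota /=; lia.
move=> pf pf' h; have sz : size f = n by rewrite (perm_size pf) size_iota.
have sz' : size f' = n by rewrite (perm_size pf') size_iota.
apply: (@eq_from_nth _ 0); rewrite sz ?sz' // => p pn.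
rewrite (key f) // (key f') //; congr _.+1; apply: eq_in_count => q.
by rewrite mem_iota => /andP[_ qn]; apply: h.
Qed.

Lemma uniq_count1 (S : eqType) (s : seq S) (P : pred S) x0 : uniq s -> x0 \in s ->
  P x0 -> (forall x, x \in s -> P x -> x = x0) -> count P s = 1.
Proof.
move=> us x0s Px0 h; rewrite (eq_in_count (a2 := pred1 x0)).
  by rewrite count_uniq_mem // x0s.
by move=> x xs /=; apply/idP/eqP => [/(h x xs)|->].
Qed.

Section Standardization.
Variables (n : nat) (la : intpart n).

Lemma intpart_sumn : sumn la = n. Proof. by case/and3P: (intpartP la) => _ _ /eqP. Qed.

Lemma intpart_sorted : sorted geq la. Proof. by case/and3P: (intpartP la). Qed.

(* Words list the entries row by row from bottom to top, as in flatten, whereas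
   ties are broken in the reading order, from the top row down. *)
Definition rho (p : nat) := rpos la (reshape_index la p) (reshape_offset la p).

Definition lexr (v : seq nat) (p q : nat) :=
  (nth 0 v p < nth 0 v q) || (nth 0 v p == nth 0 v q) && (rho p < rho q).

(* f is the standardization of v. *)
Definition compat (f v : seq nat) :=
  [forall p : 'I_n, forall q : 'I_n, (nth 0 f p < nth 0 f q) == lexr v p q].

Lemma compatP f v :
  reflect (forall p q, p < n -> q < n -> (nth 0 f p < nth 0 f q) = lexr v p q)
          (compat f v).
Proof.
apply: (iffP forallP) => [h p q pn qn|h p].
  by have /forallP/(_ (Ordinal qn))/eqP := h (Ordinal pn).
by apply/forallP => q; apply/eqP/h.
Qed.

Lemma ent_reshape v r j : size v = n -> j < nth 0 la r ->
  ent (reshape la v) r j = nth 0 v (flatten_index la r j).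
Proof.
move=> sz jr; rewrite -[in RHS](@reshapeKr _ la v) ?intpart_sumn ?sz // nth_flatten.
by rewrite reshapeKl ?intpart_sumn ?sz // flatten_indexKl // flatten_indexKr.
Qed.

Lemma rho_index r j : j < nth 0 la r -> rho (flatten_index la r j) = rpos la r j.
Proof. by move=> h; rewrite /rho flatten_indexKl // flatten_indexKr. Qed.

Lemma flatten_index_lt r j : j < nth 0 la r -> flatten_index la r j < n.
Proof. by move/flatten_indexP; rewrite intpart_sumn. Qed.

Lemma rho_inj p q : p < n -> q < n -> rho p = rho q -> p = q.
Proof.
rewrite -[in p < _]intpart_sumn -[in q < _]intpart_sumn.
move=> /reshape_offsetP hp /reshape_offsetP hq e.
have := rpos_lt hp hq; have := rpos_lt hq hp; rewrite /rho in e; rewrite e ltnn => h1 h2.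
rewrite -(reshape_indexK la p) -(reshape_indexK la q); congr flatten_index; lia.
Qed.

Lemma compat_ent f v r j r' j' : size f = n -> size v = n -> compat f v ->
  j < nth 0 la r -> j' < nth 0 la r' ->
  (ent (reshape la f) r j < ent (reshape la f) r' j') =
  (ent (reshape la v) r j < ent (reshape la v) r' j') ||
  (ent (reshape la v) r j == ent (reshape la v) r' j') &&
  ((r' < r) || (r == r') && (j < j')).
Proof.
move=> szf szv /compatP c h h'; rewrite !ent_reshape // -(rpos_lt h h').
by rewrite c ?flatten_index_lt // /lexr !rho_index.
Qed.

(** Of two equal entries the left one of a row and the upper one of a column is read first. Hence
    the standardization increases along rows when the entries increase weakly, and up columns only
    when they increase strictly. *)
Lemma compat_ssyt f v : perm_eq f (iota 1 n) -> size v = n -> compat f v ->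
  (reshape la f \in SYT la) = is_ssyt (reshape la v).
Proof.
move=> pf szv c; have szf : size f = n by rewrite (perm_size pf) size_iota.
have shf : shape (reshape la f) = la by rewrite reshapeKl // szf intpart_sumn.
have shv : shape (reshape la v) = la by rewrite reshapeKl // szv intpart_sumn.
have fl : perm_eq (rword (reshape la f)) (iota 1 n).
  by rewrite (permPl (perm_rword _)) reshapeKr // szf intpart_sumn.
apply/sytP/andP => [[_ _ hr hc]|[hr hc]]; last split=> //.
- split; first by apply/rows_sortedP => r j; rewrite shv => h;
    have := hr r j h; rewrite (compat_ent szf szv c) // ?(ltnW h) //; lia.
  apply/cols_strictP; first by rewrite shv intpart_sorted.
  move=> r j; rewrite shv => h; have := hc r j h.
  by rewrite (compat_ent szf szv c) // ?(syt_cell_below h) //; lia.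
- move=> r j h; rewrite (compat_ent szf szv c) // ?(ltnW h) //.
  by move/rows_sortedP/(_ r j): hr; rewrite shv => /(_ h); lia.
move=> r j h; rewrite (compat_ent szf szv c) // ?(syt_cell_below h) //.
by move/cols_strictP: hc; rewrite shv => /(_ intpart_sorted r j h) ->.
Qed.

Lemma ssyt_standardization v : size v = n -> is_ssyt (reshape la v) ->
  count (fun T => compat (flatten T) v) (SYT la) = 1.
Proof.
move=> sz sv; have [] := @standardization_exists n (lexr v).
- by move=> p; rewrite /lexr !ltnn andbF.
- by move=> q p r; rewrite /lexr; lia.
- move=> p q pn qn ne; have : rho p <> rho q by move/(rho_inj pn qn).
  by rewrite /lexr; lia.
move=> f pf /compatP cf; have szf : size f = n by rewrite (perm_size pf) size_iota.
have fl : flatten (reshape la f) = f by rewrite reshapeKr // szf intpart_sumn.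
apply: (@uniq_count1 _ _ _ (reshape la f)); first exact: fset_uniq.
- by rewrite (compat_ssyt pf sz cf).
- by rewrite fl.
move=> T TS /compatP cT; rewrite -(syt_shape TS) -[LHS]flattenK; congr reshape.
apply: (@standardization_unique n) => //.
  by rewrite -(permPl (perm_rword T)) (syt_perm TS).
by move=> p q pn qn; rewrite cT // (compatP _ _ cf).
Qed.

Definition fund_cond (s : signs n) (u : seq nat) :=
  sorted leq u && [forall j : 'I_n.-1, (nth 0 u j == nth 0 u j.+1) ==> tnth s j].

(** The cell with entry [x] receives the letter number [x] of [u]. Compatibility then says that the
    pairs (letter, reading position) increase lexicographically with [x]. By transitivity
    consecutive entries suffice: the letters increase weakly, with equality only where [x] is read
    before [x.+1], which is the sign +1. *)
Lemma compat_fund T u : T \in SYT la -> size u = n ->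
  compat (flatten T) [seq nth 0 u x.-1 | x <- flatten T] =
  fund_cond (signature n (rword T)) u.
Proof.
move=> TS szu; set v := map _ _; set f := flatten T.
have pf : perm_eq f (iota 1 n) by rewrite -(permPl (perm_rword T)) (syt_perm TS).
have szf : size f = n by rewrite (perm_size pf) size_iota.
pose pos x := index x (rword T).
have fp p : p < n -> nth 0 v p = nth 0 u (nth 0 f p).-1 /\ rho p = pos (nth 0 f p).
  move=> pn; rewrite (nth_map 0) ?szf //; split=> //.
  rewrite /pos /f nth_flatten (syt_shape TS) (syt_index TS) //.
  by apply: reshape_offsetP; rewrite intpart_sumn.
pose lexu a b := (nth 0 u a.-1 < nth 0 u b.-1) ||
  (nth 0 u a.-1 == nth 0 u b.-1) && (pos a < pos b).
have -> : compat f v = [forall a : 'I_n, forall b : 'I_n, (a < b) == lexu a.+1 b.+1].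
  apply/compatP/forallP => [h a|h p q pn qn].
    apply/forallP => b; apply/eqP.
    have ex (x : 'I_n) : exists2 p, p < n & x.+1 = nth 0 f p.
      have xf : x.+1 \in f by rewrite (perm_mem pf) mem_iota; case: x => x /=; lia.
      exists (index x.+1 f); last by rewrite nth_index.
      by move: xf; rewrite -index_mem szf.
    have [[p pn ep] [q qn eq]] := (ex a, ex b).
    have := h p q pn qn; rewrite -ep -eq ltnS => ->.
    by rewrite /lexr /lexu ep eq; have [-> ->] := fp _ pn; have [-> ->] := fp _ qn.
  have nf x : x < n -> 0 < nth 0 f x <= n.
    by move=> xn; rewrite -(syt_mem TS) (perm_mem (perm_rword T)) mem_nth ?szf.
  have := nf p pn; have := nf q qn => /andP[q0 qN] /andP[p0 pN].
  have pN' : (nth 0 f p).-1 < n by lia.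
  have qN' : (nth 0 f q).-1 < n by lia.
  have /forallP/(_ (Ordinal qN'))/eqP /= := h (Ordinal pN').
  rewrite !prednK //; have -> : (nth 0 f p <= (nth 0 f q).-1) =
    (nth 0 f p < nth 0 f q) by lia.
  by move=> ->; rewrite /lexr /lexu; have [-> ->] := fp _ pn; have [-> ->] := fp _ qn.
apply/idP/andP => [h|[/(sortedP 0) su /forallP cu]].
  have {}h a b : a < n -> b < n -> (a < b) = lexu a.+1 b.+1.
    by move=> an bn; move/forallP/(_ (Ordinal an))/forallP/(_ (Ordinal bn))/eqP: h.
  split.
    apply/(sortedP 0) => i; rewrite szu => lt; have := h i i.+1 (ltnW lt) lt.
    by rewrite /lexu /=; lia.
  apply/forallP => j; apply/implyP => /eqP e; rewrite tnth_mktuple.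
  have := h j j.+1; rewrite /lexu /= e eqxx ltnn ltnSn /= => <- //;
    by have := ltn_ord j; lia.
have step i : i.+1 < n -> lexu i.+1 i.+2.
  move=> lt; rewrite /lexu /=; have := su i; rewrite szu => /(_ lt).
  have lt' : i < n.-1 by lia.
  have := cu (Ordinal lt'); rewrite tnth_mktuple /=.
  by rewrite /pos; lia.
have lexlt a d : a + d.+1 < n -> lexu a.+1 (a + d.+1).+1.
  elim: d => [|d IH]; first by rewrite addn1; apply: step.
  move=> lt; have := IH ltac:(lia); have := step (a + d.+1) ltac:(lia).
  by rewrite !addnS /lexu; lia.
apply/forallP => a; apply/forallP => b; apply/eqP.
have lexlt' x y : x < y -> y < n -> lexu x.+1 y.+1.
  by move=> xy yn; have := lexlt x (y - x.+1); rewrite addnS -addSn subnKC //; apply.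
case: (ltngtP a b) => [/lexlt' ->|/lexlt'/(_ (ltn_ord a))|->] //.
- by rewrite /lexu; lia.
by rewrite /lexu !ltnn andbF.
Qed.
End Standardization.

(** * Graphs satisfying Axiom 1 *)

Lemma perm_word n (w : 'S_n) : perm_eq (word w) (iota 1 n).
Proof.
have uw : uniq (word w).
  by rewrite map_inj_uniq ?enum_uniq // => i j [/val_inj/perm_inj].
have sub : {subset word w <= iota 1 n}.
  by move=> x /mapP[j _ ->]; rewrite mem_iota add1n /= !ltnS ltn_ord.
apply: uniq_perm; rewrite ?iota_uniq //.
by case: (uniq_min_size uw sub); rewrite // size_iota size_map size_enum_ord.
Qed.

Lemma Utab_syt n (la : intpart n) : Utab la \in SYT la.
Proof.
have szi : size (iota 1 n) = n by rewrite size_iota.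
have entU r j : j < nth 0 la r ->
    ent (Utab la) r j = (sumn (take r la) + j).+1.
  move=> h; rewrite ent_reshape // nth_iota ?add1n //; exact: flatten_index_lt.
have below r j : j < nth 0 la r.+1 -> 0 < nth 0 la r.
  by move=> h; apply: leq_trans (@syt_cell_below n la r j h).
have take_S r : sumn (take r.+1 la) = sumn (take r la) + nth 0 la r.
  have [lt|ge] := ltnP r (size la); first by rewrite (take_nth 0) // sumn_rcons.
  by rewrite !take_oversize ?nth_default ?addn0 // ltnW.
apply/sytP; split.
- by rewrite reshapeKl // szi intpart_sumn.
- by rewrite (permPl (perm_rword _)) reshapeKr // szi intpart_sumn.
- by move=> r j h; rewrite !entU ?ltnS ?ltn_add2l // ltnW.
move=> r j h; rewrite !entU //; last exact: syt_cell_below.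
by rewrite take_S; have := below _ _ h; lia.
Qed.

(** * Expansion of Schur functions into fundamental quasisymmetric functions *)

Lemma monomial_perm s s' : perm_eq s s' -> monomial s = monomial s'.
Proof. by move=> p; apply: perm_big. Qed.

(** Semistandard fillings are sorted by their standardization [T]. Those belonging to a fixed [T]
    are rearrangements of the sequences counted by its fundamental function, and rearranging keeps
    the monomial. *)
Lemma schur_fund n (la : intpart n) m :
  schur la m = (\sum_(T <- SYT la) fundF (signature n (rword T)) m)%R.
Proof.
rewrite /schur /fundF /genfun -(big_morph Posz PoszD erefl); congr Posz.
set A := [set _ | _].
have -> : #|A| = \sum_(t in A) count (fun T => compat la (flatten T) (map val t)) (SYT la).
  rewrite -sum1_card; apply: eq_bigr => t; rewrite inE => /andP[st _].
  by rewrite ssyt_standardization // size_map size_tuple.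
under eq_bigr do rewrite -sum1_count big_mkcond /=.
rewrite exchange_big /=; apply: eq_big_seq => T TS.
rewrite -big_mkcondr /=.
have pf : perm_eq (flatten T) (iota 1 n).
  by rewrite -(permPl (perm_rword T)) (syt_perm TS).
have szf : size (flatten T) = n by rewrite (perm_size pf) size_iota.
have f_bd (p : 'I_n) : 0 < nth 0 (flatten T) p <= n.
  have : nth 0 (flatten T) p \in iota 1 n by rewrite -(perm_mem pf) mem_nth ?szf.
  by rewrite mem_iota.
have f_gt0 p := proj1 (andP (f_bd p)).
have f_lt (p : 'I_n) : (nth 0 (flatten T) p).-1 < n by rewrite prednK; case/andP: (f_bd p).
pose pi p := Ordinal (f_lt p).
have pi_inj : injective pi.
  move=> p q /(congr1 val) /= e; apply: ord_inj; apply/eqP.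
  rewrite -(@nth_uniq _ 0 (flatten T)) ?szf ?ltn_ord ?(perm_uniq pf) ?iota_uniq //.
  by apply/eqP; rewrite -(prednK (f_gt0 p)) -(prednK (f_gt0 q)) e.
(* A cell with entry [x] in [T] is filled with letter number [x] of [t]; [pi] subtracts 1 as tuples
   are indexed from 0. *)
pose h (t : n.-tuple (finsupp m)) := [tuple tnth t (pi p) | p < n].
have h_inj : injective h.
  move=> t t' e; apply: eq_from_tnth => j.
  have /codomP[k ->] := injF_onto pi_inj j.
  by have := congr1 (fun s => tnth s k) e; rewrite !tnth_mktuple.
have hE t : map val (h t) = [seq nth 0 (map val t) x.-1 | x <- flatten T].
  apply: (@eq_from_nth _ 0); first by rewrite size_tuple size_map szf.
  move=> p; rewrite size_map size_tuple => pn.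
  rewrite [RHS](nth_map 0) ?szf //.
  have -> : nth 0 (map val (h t)) p = val (tnth (h t) (Ordinal pn)).
    rewrite (tnth_nth (tnth (h t) (Ordinal pn))).
    by rewrite (nth_map (tnth (h t) (Ordinal pn))) // size_tuple.
  rewrite tnth_mktuple (tnth_nth (tnth (h t) (Ordinal pn))) /=.
  by rewrite (nth_map (tnth (h t) (Ordinal pn))) // size_tuple (f_lt (Ordinal pn)).
transitivity #|[set t in A | compat la (flatten T) (map val t)]|.
  by rewrite -sum1_card; apply: eq_bigl => t; rewrite inE.
rewrite -(card_preimset _ h_inj); apply: eq_card => t; rewrite !inE hE.
set u := map val t; set v := map _ _; have szu : size u = n by rewrite size_map size_tuple.
have pv : perm_eq v u.
  rewrite (perm_trans (perm_map _ pf)) // -[X in perm_eq _ X](mkseq_nth 0 u) szu /mkseq.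
  by rewrite -[iota 1 n]/(iota (1 + 0) n) iotaDl -map_comp perm_refl.
rewrite (monomial_perm pv) -/(fund_cond _ u) -(compat_fund TS szu) -/v.
have [c|] := boolP (compat _ _ _); last by rewrite andbF.
rewrite -(compat_ssyt pf _ c); last by rewrite size_map.
have -> : reshape la (flatten T) = T by rewrite -(syt_shape TS) flattenK.
by rewrite TS andbT.
Qed.

(** * Edges and neighbours in a complete matching *)

Section Matching.
Variables (n : nat) (K : choiceType) (G : scgraph n K).
Hypothesis G1 : axiom1 G.
Variable i : nat.
Hypothesis ni : 1 < i < n.

Lemma edge_admits u v : [fset u; v]%fset \in edges G i ->
  [/\ u \in vert G, v \in vert G, u != v & admits (sig G u) i].
Proof.
move=> e; have [sub _] := G1 ni; have /andP[/fsubsetP uv] := sub _ e.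
rewrite cardfs2 eqSS eqb1 => ne.
have := uv u (fset21 u v); have := uv v (fset22 u v); rewrite !inE /=.
by move=> /andP[vV _] /andP[uV au]; split.
Qed.

Lemma edge_unique u v v' : [fset u; v]%fset \in edges G i ->
  [fset u; v']%fset \in edges G i -> v = v'.
Proof.
move=> e e'; have [uV _ uv au] := edge_admits e; have [_ uniqe] := G1 ni.
have /uniqe[e0 [_ ue]] : u \in [fset v in vert G | admits (sig G v) i]%fset.
  by rewrite !inE uV.
have e0E w : [fset u; w]%fset \in edges G i -> e0 = [fset u; w]%fset.
  by move=> ew; apply: ue; rewrite ew fset21.
have : v \in [fset u; v']%fset by rewrite -(e0E _ e') (e0E _ e) fset22.
by rewrite in_fset2 eq_sym (negPf uv) => /eqP.
Qed.

Lemma edge_nbr v : v \in vert G -> admits (sig G v) i ->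
  [fset v; nbr G i v]%fset \in edges G i.
Proof.
move=> vV av; rewrite /nbr; case: pickP => [u //|none]; exfalso.
have [sub ex] := G1 ni.
have /ex[e [/andP[ee ve] _]] : v \in [fset v in vert G | admits (sig G v) i]%fset.
  by rewrite !inE vV.
have /andP[/fsubsetP se /eqP ce] := sub _ ee.
have [u ue uv] : exists2 u, u \in e & u != v.
  have : 0 < #|` (e `\ v)%fset| by rewrite (cardfsD1 v) ve in ce; case: ce; rewrite add0n => ->.
  by rewrite cardfs_gt0 => /fset0Pn[u]; rewrite in_fsetD1 => /andP[]; exists u.
have eE : [fset v; u]%fset = e.
  apply/eqP; rewrite eqEfcard cardfs2 eq_sym uv ce leqnn andbT.
  by apply/fsubsetP => x; rewrite in_fset2 => /orP[]/eqP->.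
have uV : u \in vert G by have := se u ue; rewrite !inE => /andP[].
by have := none [` uV]%fset; rewrite /= eE ee.
Qed.

Lemma nbr_edge u v : [fset u; v]%fset \in edges G i -> nbr G i u = v.
Proof.
move=> e; have [uV _ _ au] := edge_admits e.
exact: edge_unique (edge_nbr uV au) e.
Qed.

End Matching.

(** * The morphism and the fibers of the insertion tableau *)

Lemma Ptab_union n (v : 'S_n) : Ptab (word v) \in vert (Gunion n).
Proof.
have [la h] := Ptab_syt (perm_word v).
by apply/bigfcupP; exists la; rewrite ?mem_enum.
Qed.

Section Fibers.
Variables (n : nat) (G : scgraph n 'S_n).
Hypothesis G1 : axiom1 G.
Hypothesis Gsig : forall v : 'S_n, v \in vert G -> sig G v = signature n (word v).
Hypothesis Gknuth : forall (i : nat) (v : 'S_n), 1 < i < n -> v \in vert G ->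
  admits (sig G v) i -> knuth_equiv (word (nbr G i v)) (dword i (word v)).

(** The Knuth equivalence hypothesis, read through P: an edge of colour [i] becomes the action of
    d_i. *)
Lemma edge_Ptab i u v : 1 < i < n -> [fset u; v]%fset \in edges G i ->
  Ptab (word v) = dtab i (Ptab (word u)).
Proof.
move=> ni e; have [uV _ _ au] := edge_admits G1 ni e.
rewrite -(Ptab_dword (perm_word u) ni) -(nbr_edge G1 ni e); exact: Gknuth.
Qed.

Lemma Ptab_morphism : scg_morphism G (Gunion n) (fun v => Ptab (word v)).
Proof.
split=> [v _|v vV|i u v ni e]; first exact: Ptab_union.
  by rewrite /= signature_Ptab ?perm_word // Gsig.
have [uV vV _ au] := edge_admits G1 ni e; have eP := edge_Ptab ni e.
have [la uS] := Ptab_syt (perm_word u).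
have [dS _] := dtab_syt uS ni.
apply/bigfcupP; exists la; first by rewrite mem_enum.
apply/imfset2P; exists (Ptab (word u)) => //; exists (Ptab (word v)) => //=.
(* The image is a genuine pair: [u] admits an [i]-neighbour and P keeps signatures, so d_i moves the
   tableau of [u]. *)
rewrite inE /= eP dS eqxx /= (dtab_neq uS ni).
by rewrite signature_Ptab ?perm_word // -Gsig.
Qed.

Definition fiber (T : tableau) := [seq v <- vert G | Ptab (word v) == T].

(** As d_i moves [T], the signature of [T] admits an [i]-neighbour. All permutations over [T] share
    this signature, so each is matched, to a partner over [dtab i T], and a matching is
    injective. *)
Lemma fiber_dtab_le (la : intpart n) T i : T \in SYT la -> 1 < i < n -> dtab i T != T ->
  size (fiber T) <= size (fiber (dtab i T)).
Proof.
move=> TS ni dT; have fib v : v \in fiber T ->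
    [/\ v \in vert G, Ptab (word v) = T & [fset v; nbr G i v]%fset \in edges G i].
  rewrite mem_filter => /andP[/eqP PT vV]; split=> //; apply: edge_nbr => //.
  by rewrite Gsig // -signature_Ptab ?perm_word // PT -(dtab_neq TS ni).
rewrite -(size_map (nbr G i)); apply: uniq_leq_size.
  rewrite map_inj_in_uniq ?filter_uniq ?fset_uniq // => v v' /fib[_ _ e] /fib[_ _ e'] h.
  rewrite fsetUC in e; rewrite -h fsetUC in e'; exact: (edge_unique G1 ni e e').
move=> _ /mapP[v /fib[vV PT e] ->]; have [_ nV _ _] := edge_admits G1 ni e.
by rewrite mem_filter nV andbT (edge_Ptab ni e) PT.
Qed.

Lemma fiber_dtab (la : intpart n) T i : T \in SYT la -> 1 < i < n ->
  size (fiber (dtab i T)) = size (fiber T).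
Proof.
move=> TS ni; have [->//|dT] := eqVneq (dtab i T) T.
have [dS _] := dtab_syt TS ni; apply/eqP; rewrite eqn_leq (fiber_dtab_le TS) // andbT.
have := fiber_dtab_le dS ni; rewrite (dtabK TS ni); apply.
by rewrite eq_sym.
Qed.

Lemma fiber_const (la : intpart n) T : T \in SYT la ->
  size (fiber T) = #|` (vert G `&` SYam la)%fset|.
Proof.
move=> TS; have fd T' i : T' \in SYT la -> 1 < i < n ->
    size (fiber (dtab i T')) = size (fiber T') by exact: fiber_dtab.
have -> : size (fiber T) = size (fiber (Utab la)).
  exact: (dual_connected (f := fun T => size (fiber T)) fd TS (Utab_syt la)).
apply/perm_size/uniq_perm; rewrite ?filter_uniq ?fset_uniq // => v.
by rewrite mem_filter !inE andbC.
Qed.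

(** The multiplicity of the Schur function is rewritten, for each tableau [T] of shape [la], as the
    size of the fiber over [T]. After exchanging the sums, a vertex [v] contributes only for [T]
    equal to its insertion tableau, whose shape fixes [la]. *)
Lemma fund_expansion m :
  (\sum_(v <- vert G) fundF (sig G v) m =
   \sum_(la : intpart n) schur la m *+ #|` (vert G `&` SYam la)%fset|)%R.
Proof.
under [RHS]eq_bigr => la _.
  rewrite schur_fund -sumrMnl.
  under eq_big_seq => T TS.
    rewrite -(fiber_const TS) size_filter -sum1_count -sumrMnr big_mkcond /=.
    over.
  over.
under [RHS]eq_bigr do rewrite exchange_big /=.
rewrite exchange_big /=; apply: eq_big_seq => v vV.
have [la0 PS] := Ptab_syt (perm_word v).
rewrite (bigD1 la0) //= [X in (_ + X)%R]big1 ?addr0.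
  rewrite (bigD1_seq (Ptab (word v))) ?fset_uniq //= eqxx big1 ?addr0 ?mulr1n.
    by rewrite Gsig // -signature_Ptab ?perm_word.
  by move=> T; rewrite eq_sym => /negPf->.
move=> la ne; apply: big1_seq => T /= TS; case: eqP => // e.
case/eqP: ne; apply: val_inj; rewrite /= -(syt_shape TS) -(syt_shape PS) e //.
Qed.

End Fibers.

Theorem theorem3p13 (n : nat) (G : scgraph n 'S_n) :
  axiom1 G ->
  (forall v : 'S_n, v \in vert G -> sig G v = signature n (word v)) ->
  (forall (i : nat) (v : 'S_n), 1 < i < n -> v \in vert G ->
     admits (sig G v) i -> knuth_equiv (word (nbr G i v)) (dword i (word v))) ->
  scg_morphism G (Gunion n) (fun v => Ptab (word v)) /\
  (fun m : {cmonom nat} => \sum_(v <- vert G) fundF (sig G v) m)%R =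
  (fun m : {cmonom nat} =>
     \sum_(la : intpart n) schur la m *+ #|` (vert G `&` SYam la)%fset|)%R.
Proof.
move=> G1 Gsig Gknuth; split; first exact: Ptab_morphism.
by apply: functional_extensionality => m; apply: fund_expansion.
Qed.
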